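(* Let $\mathscr{M}_{n,q}$ be the set of all $n$-vertex trees with matching number $q$. Among the trees in $\mathscr{M}_{n,q}$, precisely the tree $A(n,q)$ maximizes the total number of subtrees $F$, and $$F(A(n,q))=2^{n-2q+1}\cdot 3^{q-1}+n+q-2.$$ Likewise, among the trees in $\mathscr{M}_{n,q}$, precisely the tree $A(n,q)$ maximizes the total number of leaf containing subtrees $F^*$, and $$F^*(A(n,q))=2^{n-2q+1}\cdot 3^{q-1}-2^{q-1}+n-1.$$
   Context: All graphs are finite and simple. A leaf (pendant vertex) of a tree is a vertex of degree $1$. A subtree of a tree $T$ is a (nonempty) connected induced subgraph of $T$. $F(T)$ denotes the number of subtrees of $T$, and $F^*(T)$ denotes the number of subtrees of $T$ that contain at least one leaf of $T$ (leaf containing subtrees). The matching number of a graph is the maximum size of a set of pairwise nonincident edges. $K_{1,m}$ is the star with $m+1$ vertices. $A(n,q)$ is the $n$-vertex tree obtained from the star $K_{1,n-q}$ by attaching $q-1$ pendant edges to $q-1$ of its pendant vertices, one to each; it lies in $\mathscr{M}_{n,q}$.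
   Formalization: The formula for F*(A(n,q)) is stated only for n > 2: for (n,q) = (2,1), A(2,1) is a single edge with F* = 3, while the formula gives 2; q ≥ 1 and n ≥ 2q are assumed so that A(n,q) is defined and lies in M_{n,q}. *)

(* Defs.v *)
From mathcomp Require Import all_boot.

Set Implicit Arguments.
Unset Strict Implicit.
Unset Printing Implicit Defensive.

Record sgraph := SGraph {
  vertex :> finType;
  edge : rel vertex;
  edge_sym : symmetric edge;
  edge_irr : irreflexive edge }.

Arguments edge {G} : rename.

Definition connected (G : sgraph) : bool :=
  (0 < #|G|) && [forall x : G, forall y : G, connect edge x y].

Definition acyclic (G : sgraph) : Prop :=
  forall c : seq G, 2 < size c -> ~ ucycle edge c.

Definition tree (G : sgraph) : Prop := connected G /\ acyclic G.

Definition iso (G H : sgraph) : Prop :=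
  exists2 f : G -> H, bijective f & forall x y, edge (f x) (f y) = edge x y.

Section Induced.
Variables (G : sgraph) (S : {set G}).

Definition induced_edge : rel {x : G | x \in S} :=
  fun x y => edge (val x) (val y).

Lemma induced_sym : symmetric induced_edge.
Proof. by move=> x y; apply: edge_sym. Qed.

Lemma induced_irr : irreflexive induced_edge.
Proof. by move=> x; apply: edge_irr. Qed.

Definition induced : sgraph := SGraph induced_sym induced_irr.
End Induced.

Section Invariants.
Variable G : sgraph.

Definition leaf (x : G) : bool := #|[set y | edge x y]| == 1.

(* In a tree, a connected induced subgraph is automatically acyclic; it is
   determined by its vertex set, so counting subtrees is counting sets. *)
Definition subtree (S : {set G}) : bool := connected (induced S).

Definition num_subtrees : nat := #|[set S | subtree S]|.

(* Leaves are those of the whole graph G, not of the subtree. *)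
Definition num_leaf_subtrees : nat :=
  #|[set S | subtree S && [exists x in S, leaf x]]|.

Definition edge_set : {set {set G}} :=
  [set e : {set G} | [exists x, exists y, edge x y && (e == [set x; y])]].

Definition matching (M : {set {set G}}) : bool :=
  (M \subset edge_set) && trivIset M.

Definition matching_number : nat := \max_(M | matching M) #|M|.
End Invariants.

Definition trees_with_matching (n q : nat) (G : sgraph) : Prop :=
  [/\ tree G, #|G| = n & matching_number G = q].

Definition maximizes (P : sgraph -> Prop) (f : sgraph -> nat) (G : sgraph) :
  Prop := P G /\ forall H, P H -> f H <= f G.

(* The star K_{1,m}: [None] is the centre, the [Some i] are its leaves. *)
Definition star_edge (m : nat) : rel (option 'I_m) :=
  fun x y => (x == None) (+) (y == None).

Section AGraph.
Variables n q : nat.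

(* [inl x] is a vertex x of the star K_{1,n-q}; [inr j] is the pendant vertex
   attached to the j-th leaf of the star, for j < q - 1.  Every [inr j] does
   have a neighbour as soon as 0 < q and 2q <= n. *)
Definition A_edge : rel (option 'I_(n - q) + 'I_q.-1) :=
  fun u v => match u, v with
    | inl x, inl y => star_edge x y
    | inl (Some i), inr j | inr j, inl (Some i) => i == j :> nat
    | _, _ => false
    end.

Lemma A_edge_sym : symmetric A_edge.
Proof. by move=> [[i|]|j] [[k|]|l]. Qed.

Lemma A_edge_irr : irreflexive A_edge.
Proof. by move=> [[i|]|j]. Qed.

Definition A_graph : sgraph := SGraph A_edge_sym A_edge_irr.
End AGraph.

(* Main.v *)
Require Import Defs.
From mathcomp Require Import all_boot zify.

Set Implicit Arguments.
Unset Strict Implicit.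
Unset Printing Implicit Defensive.

(** Fix a matching of size [q] in a tree on [n] vertices and root the tree at
    [r]. A subtree through [r] that contains a vertex contains its parent, so it
    meets each matched pair away from [r] in one of three ways: not at all, in
    the upper vertex, or in both. Hence at most [2 ^ (n - 2q + 1) * 3 ^ (q - 1)]
    subtrees contain [r] ([card_rooted]). In the case of equality every choice
    of these local patterns gives a connected set; choosing one vertex at a time
    shows that all vertices except the lower ends of the matched pairs away from
    [r] are neighbours of [r], so the tree is a spider: a star some of whose legs
    have been lengthened by one edge. These are the trees [A(n, q)].

    The bound on all subtrees follows by induction on [n], with everything taking
    place on vertex sets of one acyclic graph. If [n > 2q], the matching can be
    shifted so as to miss a leaf [x] ([free_leaf]); deleting [x] with neighbour
    [y] loses [{x}] and as many subtrees as there are through [y] in the rest. If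
    the matching is perfect, some matched pair consists of a leaf [x] and a
    vertex [y] of degree two ([matched_leg]); deleting both loses three subtrees
    and twice as many as there are through the other neighbour [z] of [y]. The
    rooted bound makes both steps exact for [A(n, q)], and equality in the total
    forces equality in the rooted bound, so the spider is read off from the last
    step alone.

    The same induction counts the subtrees with a leaf, provided that leaf means
    leaf of the whole graph throughout and that the vertex set keeps a vertex
    that is not a leaf. In the second case one must also see that, among the
    patterns through [z], the [2 ^ (q - 2)] ones made of [z] and upper ends only
    contain no leaf ([card_rooted_leaf]).

    Conversely the patterns in a spider are all connected; together with the
    single vertices and the edges that miss the centre they reach both bounds.
    A spider is determined up to isomorphism by its numbers of vertices and of
    feet ([spider_iso]), and the latter is its matching number minus one. *)

(** * Connected vertex sets *)

Lemma connect_map (T T' : finType) (e : rel T) (e' : rel T') (f : T -> T') x y :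
  (forall u v, e u v -> e' (f u) (f v)) ->
  connect e x y -> connect e' (f x) (f y).
Proof.
move=> fe /connectP[s]; elim: s x => [|u s IHs] x /= => [_ -> //|].
case/andP=> /fe xu us ylast; apply: connect_trans (connect1 xu) _.
exact: IHs.
Qed.

Section VertexSets.
Variable G : sgraph.
Implicit Types (S U W A B : {set G}) (Q : pred {set G}) (c r x y z : G).

Definition within W : rel G := fun u v => [&& u \in W, v \in W & edge u v].

Definition cset W : bool :=
  (W != set0) && [forall x in W, forall y in W, connect (within W) x y].

Lemma within_sym W : symmetric (within W).
Proof. by move=> u v; rewrite /within edge_sym andbCA. Qed.

Lemma csetP W :
  reflect (W != set0 /\ {in W &, forall x y, connect (within W) x y}) (cset W).
Proof.
apply: (iffP andP) => -[W0 Wc]; split=> //.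
  by move=> x y xW yW; have /forall_inP/(_ y yW) := forall_inP Wc x xW.
by apply/forall_inP=> x xW; apply/forall_inP=> y yW; apply: Wc.
Qed.

Lemma subtree_cset S : subtree S = cset S.
Proof.
have cardS : (0 < #|induced S|) = (S != set0).
  by rewrite card_sig -card_gt0; congr (0 < _); apply: eq_card => x; rewrite !inE.
rewrite /subtree /connected cardS /cset.
case: (boolP (S != set0)) => [/set0Pn[x0 x0S] /=|//].
pose g (u : G) : induced S := insubd (Sub x0 x0S : {x : G | x \in S}) u.
have gK u : u \in S -> val (g u) = u by move=> uS; rewrite insubdK.
have valg (x : induced S) : g (val x) = x by rewrite /g valKd.
apply/forallP/forall_inP => [Sc x xS | Sc x].
  apply/forall_inP => y yS; rewrite -(gK x xS) -(gK y yS).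
  apply: (connect_map (e := edge)) (forallP (Sc (g x)) (g y)) => u v uv.
  by rewrite /within !(valP u, valP v).
apply/forallP => y; rewrite -(valg x) -(valg y).
have Sxy := forall_inP (Sc _ (valP x)) _ (valP y).
apply: connect_map Sxy => u v /and3P[uS vS uv].
by rewrite /= /induced_edge !gK.
Qed.

Lemma cset_neq0 W : cset W -> W != set0.
Proof. by case/andP. Qed.

(** Connectedness is mostly used in this form: a part of [W] that no edge of
    [W] leaves is all of [W]. *)
Lemma cset_spread W A x :
  cset W -> x \in W -> x \in A ->
  (forall u v, u \in W -> v \in W -> u \in A -> edge u v -> v \in A) ->
  W \subset A.
Proof.
case/csetP=> _ Wc xW xA Aclosed; apply/subsetP=> y yW.
have clA : closed (within W) A.
  apply: intro_closed; first exact: sym_connect_sym (within_sym W).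
  by move=> u v /and3P[uW vW uv] uA; apply: Aclosed uv.
by rewrite -(closed_connect clA (Wc _ _ xW yW)).
Qed.

Lemma cset_star W c :
  c \in W -> (forall x, x \in W -> connect (within W) x c) -> cset W.
Proof.
move=> cW Wc; apply/csetP; split; first by apply/set0Pn; exists c.
move=> x y xW yW; apply: connect_trans (Wc x xW) _.
by rewrite (sym_connect_sym (within_sym W)) Wc.
Qed.

Lemma cset1 x : cset [set x].
Proof.
by apply: (cset_star (c := x)) => [|y]; rewrite inE // => /eqP->; exact: connect0.
Qed.

Lemma cset_add W x y : cset W -> y \in W -> edge x y -> cset (x |: W).
Proof.
case/csetP=> _ Wc yW xy; apply: (@cset_star _ y); first by rewrite !inE yW orbT.
move=> u /setU1P[->|uW]; first by apply: connect1; rewrite /within !inE eqxx yW orbT.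
have := Wc _ _ uW yW; apply: (connect_map (f := id)) => a b /and3P[aW bW ab].
by rewrite /within !inE aW bW ab !orbT.
Qed.

Lemma cset2 x y : edge x y -> cset [set x; y].
Proof. by move=> xy; apply: cset_add xy; [exact: cset1 | rewrite inE]. Qed.

Lemma cset_nbr W x : cset W -> x \in W -> W != [set x] ->
  exists2 y, y \in W & edge x y.
Proof.
move=> Wc xW Wx.
case: (boolP [exists y in W, edge x y]) => [/exists_inP//|/exists_inPn no].
case/eqP: Wx; apply/eqP; rewrite eqEsubset sub1set xW andbT.
apply: (cset_spread Wc xW); first by rewrite inE.
by move=> u v _ vW /set1P-> xv; case/negP: (no v vW).
Qed.

(** Removing a pendant vertex [x] keeps a set connected: collect the vertices
    reachable inside [W :\ x], and add [x] once its only neighbour is there;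
    no edge of [W] leaves this collection. *)
Lemma cset_del W x y :
  cset W -> x \in W -> (forall v, v \in W -> edge x v -> v = y) ->
  W != [set x] -> y \in W :\ x /\ cset (W :\ x).
Proof.
move=> Wc xW xy Wx.
have [y' y'W xy'] := cset_nbr Wc xW Wx; have y'y := xy _ y'W xy'; subst y'.
have yx : y != x by apply: contraTneq xy' => ->; rewrite edge_irr.
have yWx : y \in W :\ x by rewrite !inE yx.
split=> //; apply: (cset_star yWx) => u uWx.
pose A := [set w | connect (within (W :\ x)) y w] :|: [set x].
have /subsetP WA : W \subset A.
  apply: (cset_spread Wc y'W); first by rewrite !inE connect0.
  move=> a b aW bW; rewrite !inE; have [->|bx] := eqVneq b x; first by rewrite orbT.
  rewrite !orbF => /orP[ya|/eqP-> xb]; last by rewrite (xy b bW xb) connect0.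
  have [->|ax ab] := eqVneq a x; first by move=> xb; rewrite (xy b bW xb) connect0.
  by apply: connect_trans ya (connect1 _); rewrite /within !inE ax bx aW bW.
rewrite (sym_connect_sym (within_sym _)).
move: uWx; rewrite !inE => /andP[ux uW]; have := WA u uW.
by rewrite !inE (negPf ux) orbF.
Qed.

(** The only way in which acyclicity enters: two neighbours of [x] in a
    connected set avoiding [x] would be joined by a path that closes up to a
    cycle through [x]. *)
Lemma acyclic_nbr_inj W x y y' :
  acyclic G -> cset W -> x \notin W -> y \in W -> y' \in W ->
  edge x y -> edge x y' -> y = y'.
Proof.
move=> Gac /csetP[_ Wc] xW yW y'W xy xy'; apply/eqP/negPn/negP=> yy'.
have /connectP[s0 Ws0 s0y'] := Wc _ _ yW y'W.
case/shortenP: Ws0 s0y' => s Ws us _ sy' {s0}.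
have sW : {subset s <= W}.
  elim: s y {yy' yW xy us sy'} Ws => // a s IHs y /= /andP[/and3P[_ aW _] Ws] u.
  by rewrite inE => /predU1P[->//|]; apply: IHs Ws u.
apply: (Gac (x :: y :: s)).
  by case: s sy' {Ws us sW} => //= yy; rewrite yy eqxx in yy'.
apply/andP; split.
  rewrite /= rcons_path -sy' (edge_sym y' x) xy' xy andbT /=.
  by apply: sub_path Ws => a b /and3P[].
rewrite cons_uniq us andbT inE negb_or; apply/andP; split.
  by apply: contraNneq xW => ->.
by apply: contra xW => /sW.
Qed.

End VertexSets.

(** * Rooted trees and matchings *)

Section Rooted.
Variable G : sgraph.
Implicit Types (S U W A B : {set G}) (Q : pred {set G}) (b c r x y z : G).
Implicit Types (p m : G -> G) (d : G -> nat).

(** The function [d] need not be the distance to [r]: any potential increasing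
    away from the root will do. The last clause says that connected sets through
    the root are closed under taking parents; it follows from the others, but
    comes for free when the tree is grown vertex by vertex. *)
Definition rooted U r p d : Prop :=
  [/\ r \in U,
      forall x, x \in U -> x != r -> p x \in U /\ d (p x) < d x,
      forall x y, x \in U -> y \in U ->
        edge x y = (x != r) && (p x == y) || (y != r) && (p y == x)
    & forall S x, S \subset U -> cset S -> r \in S -> x \in S -> x != r ->
        p x \in S].

Lemma rooted1 r : rooted [set r] r id (fun=> 0).
Proof.
split=> [|x /set1P->|x y /set1P-> /set1P->|S x].
- by rewrite inE.
- by rewrite eqxx.
- by rewrite edge_irr eqxx.
- by [].
Qed.

Lemma rooted_add U r p d x y :
  rooted U r p d -> x \notin U -> y \in U -> edge x y ->
  (forall v, v \in U -> edge x v -> v = y) ->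
  rooted (x |: U) r [eta p with x |-> y] [eta d with x |-> (d y).+1].
Proof.
case=> rU pU eU cU xU yU xy xy1.
have neqx v : v \in U -> (v == x) = false.
  by move=> vU; apply: contraNF xU => /eqP<-.
have xr : (x == r) = false by rewrite eq_sym neqx.
split=> [|v /setU1P[->|vU] vr|u v|S b SU Sc rS bS br] /=.
- by rewrite !inE rU orbT.
- by rewrite !eqxx (neqx y) // !inE yU orbT.
- have [pvU dv] := pU v vU vr.
  by rewrite (neqx v) // (neqx (p v)) // !inE pvU orbT.
- have ex w : w \in U -> edge x w = (y == w).
    move=> wU; apply/idP/eqP => [/(xy1 _ wU)->//|<- //].
  move=> /setU1P[->|uU] /setU1P[->|vU].
  + by rewrite edge_irr eqxx (neqx y yU) andbF.
  + rewrite ex // eqxx xr (neqx v vU) /=; case: eqP => //= _.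
    case: (v =P r) => //= /eqP vr; apply/esym/negbTE.
    by have [pv _] := pU v vU vr; rewrite (neqx _ pv).
  + rewrite edge_sym ex // eqxx xr (neqx u uU) /= orbC; case: eqP => //= _.
    case: (u =P r) => //= /eqP vr; apply/esym/negbTE.
    by have [pv _] := pU u uU vr; rewrite (neqx _ pv).
  + by rewrite eU // (neqx u uU) (neqx v vU).
- have Sxr : S != [set x] by apply: contraTneq rS => ->; rewrite inE eq_sym xr.
  have SxU : S :\ x \subset U.
    by apply/subsetP=> v; rewrite !inE => /andP[vx /(subsetP SU)/setU1P[/eqP|//]];
      rewrite (negPf vx).
  have xyS v : v \in S -> edge x v -> v = y.
    move=> vS xv; apply: xy1 (xv); apply: (subsetP SxU).
    by rewrite !inE vS andbT; apply: contraTneq xv => ->; rewrite edge_irr.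
  have [xS|xS] := boolP (x \in S).
    have [yS Sxc] := cset_del Sc xS xyS Sxr.
    case: eqP => [_|/eqP bx]; first by case/setD1P: yS.
    have := cU _ b SxU Sxc; rewrite !inE eq_sym xr rS bx bS => /(_ isT isT br).
    by case/andP.
  have Sx : S :\ x = S.
    by apply/setP=> v; rewrite !inE andb_idl // => vS; apply: contraNneq xS => <-.
  rewrite Sx in SxU; case: eqP => [bx|_]; first by rewrite -bx bS in xS.
  exact: cU.
Qed.

(** Grow the tree from the root; acyclicity makes every new vertex pendant. *)
Lemma rooted_exists U r :
  acyclic G -> cset U -> r \in U -> exists p d, rooted U r p d.
Proof.
move=> Gac Uc rU.
suff grow k : forall W p d, #|U :\: W| <= k -> W \subset U -> cset W ->
    rooted W r p d -> exists p d, rooted U r p d.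
  apply: (grow #|U :\: [set r]| [set r]) (rooted1 r) => //; last exact: cset1.
  by rewrite sub1set.
elim: k => [|k IHk] W p d cardUW WU Wc Wr.
  suff -> : U = W by exists p, d.
  apply/eqP; rewrite eqEsubset WU andbT -setD_eq0 -cards_eq0.
  by rewrite -leqn0.
have [UW|UW] := boolP (U \subset W).
  by exists p, d; have -> : U = W by apply/eqP; rewrite eqEsubset UW.
have [rW _ _ _] := Wr.
case: (boolP [exists x in U :\: W, exists y in W, edge x y]); last first.
  move=> no; case/negP: UW; apply: (cset_spread Uc rU rW) => u v uU vU uW uv.
  apply: contraNT no => vW; apply/exists_inP; exists v; first by rewrite inE vW.
  by apply/exists_inP; exists u => //; rewrite edge_sym.
case/exists_inP=> x /setDP[xU xW] /exists_inP[y yW xy].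
apply: (IHk (x |: W) _ _ _ _ _ (rooted_add Wr xW yW xy _)).
- rewrite -ltnS; apply: leq_trans _ cardUW; apply: proper_card.
  apply/properP; split; first by apply/setDS/subsetUr.
  by exists x; rewrite !inE ?xU ?xW // eqxx.
- by rewrite subUset sub1set xU.
- exact: cset_add xy.
- by move=> v vW xv; apply: (acyclic_nbr_inj Gac Wc xW).
Qed.

(** A matching inside [U], encoded by the involution that swaps matched
    vertices and fixes the others. *)
Definition matching_on U m : Prop :=
  forall x, x \in U -> [/\ m x \in U, m (m x) = x & m x != x -> edge x (m x)].

Definition covered U m : {set G} := [set x in U | m x != x].

Lemma matching_on_sub U W m :
  matching_on U m -> W \subset U -> (forall x, x \in W -> m x \in W) ->
  matching_on W m.
Proof. by move=> mU WU mW x xW; have [_ ? ?] := mU x (subsetP WU x xW); split; auto. Qed.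

(** The matched pairs away from the root [r], named by their lower vertex. *)
Definition lower U r p m : {set G} :=
  [set b in U | [&& b != r, p b != r & m b == p b]].

Definition configs U r p B : {set {set G}} :=
  [set S : {set G} | [&& S \subset U, r \in S
                      & [forall b in B, (b \in S) ==> (p b \in S)]]].

Definition lowers U r p B : Prop :=
  [/\ B \subset U :\ r, p @: B \subset (U :\ r) :\: B & {in B &, injective p}].

Lemma lower_lowers U r p d m :
  rooted U r p d -> matching_on U m -> lowers U r p (lower U r p m).
Proof.
case=> _ pU _ _ mU; split.
- by apply/subsetP=> b; rewrite !inE => /and4P[-> ->].
- apply/subsetP=> _ /imsetP[b + ->]; rewrite !inE => /and4P[bU br pbr /eqP mb].
  have [pbU dpb] := pU b bU br; rewrite pbU pbr /= andbT.
  have [_ mmb _] := mU b bU.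
  apply/negP => /andP[ppbr]; rewrite -mb mmb => /eqP bE.
  have [_] := pU _ pbU pbr; rewrite -mb -bE mb => /ltnW.
  by rewrite leqNgt dpb.
- move=> b b'; rewrite !inE => /and4P[bU _ _ /eqP mb] /and4P[b'U _ _ /eqP mb'].
  have [_ mmb _] := mU b bU; have [_ mmb' _] := mU b' b'U.
  by move=> pbb'; rewrite -mmb -mmb' mb mb' pbb'.
Qed.

Lemma card_lower U r p d m q :
  rooted U r p d -> matching_on U m -> #|covered U m| = 2 * q ->
  #|lower U r p m| + (m r != r) = q.
Proof.
move=> Ur mU cq; have [rU pU eU _] := Ur.
have [BU pBU pinj] := lower_lowers Ur mU.
set B := lower U r p m in BU pBU pinj *.
have cov : covered U m = (B :|: p @: B) :|: [set x in [set r; m r] | m r != r].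
  have [mrU mmr _] := mU r rU.
  apply/setP=> x; rewrite [in LHS]inE; apply/andP/idP => [[xU mx]|].
    rewrite !inE; have [mxU mmx /(_ mx) xmx] := mU x xU.
    have [xr|xr] := eqVneq x r; first by move: mx; rewrite xr => ->; rewrite orbT.
    have [xmr|xmr] := eqVneq x (m r).
      by move: mx; rewrite xmr mmr eq_sym => -> /=; rewrite orbT.
    rewrite /= orbF; have mxr : m x != r by apply: contraNneq xmr => <-; rewrite mmx.
    move: xmx; rewrite eU // xr mxr /= => /orP[/eqP pmx|/eqP pmx].
      by rewrite xU pmx mxr eqxx.
    apply/orP; right; apply/imsetP; exists (m x) => //.
    by rewrite inE mxU mxr pmx xr mmx eqxx.
  case/setUP=> [/setUP[|/imsetP[b + ->]]|].
  - rewrite !inE => /and4P[xU xr pxr /eqP mx]; split=> //; rewrite mx.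
    by apply/eqP => px; have [_] := pU x xU xr; rewrite px ltnn.
  - rewrite !inE => /and4P[xU xr pxr /eqP mx]; have [pbU dpb] := pU b xU xr.
    split=> //; have [_ mmb _] := mU b xU; rewrite -mx mmb mx.
    by apply/eqP => px; rewrite -px ltnn in dpb.
  rewrite !inE => /andP[/pred2P[]-> mr]; split=> //.
  by rewrite mmr eq_sym.
have disj1 : [disjoint B & p @: B].
  by rewrite disjoint_sym disjoints_subset (subset_trans pBU) // subsetDr.
have disj2 : [disjoint B :|: p @: B & [set x in [set r; m r] | m r != r]].
  have [mrU mmr _] := mU r rU.
  rewrite -setI_eq0; apply/eqP/setP=> x; rewrite !inE.
  apply/negP => /andP[/orP[|/imsetP[b + ->]]].
    case/and4P=> xU xr pxr /eqP mx /andP[/pred2P[xr'|xmr] mr].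
      by rewrite xr' eqxx in xr.
    by case/eqP: pxr; rewrite -mx xmr.
  rewrite inE => /and4P[xU xr pxr /eqP mx] /andP[/pred2P[xr'|xmr] mr].
    by rewrite xr' eqxx in pxr.
  have [_ mmb _] := mU b xU.
  by case/eqP: xr; rewrite -mmb mx xmr mmr.
move: cq; rewrite cov !cardsU (disjoint_setI0 disj1) (disjoint_setI0 disj2).
rewrite cards0 !subn0 card_in_imset //.
have -> : #|[set x in [set r; m r] | m r != r]| = 2 * (m r != r).
  have [_|mr] := eqVneq (m r) r; last first.
    by rewrite (_ : [set x in _ | _] = [set r; m r]) ?cards2 1?eq_sym ?mr //;
      apply/setP=> x; rewrite !inE andbT.
  by rewrite (_ : [set x in _ | _] = set0) ?cards0 //; apply/setP=> x; rewrite !inE andbF.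
lia.
Qed.

End Rooted.

(** Each pair [b, p b] contributes a factor 3 and each vertex outside the pairs
    a factor 2. *)
Lemma card_closed (T : finType) (W B : {set T}) (p : T -> T) k :
  B \subset W -> p @: B \subset W :\: B -> {in B &, injective p} ->
  #|W| = 2 * #|B| + k ->
  #|[set S : {set T} | (S \subset W) &&
      [forall b in B, (b \in S) ==> (p b \in S)]]| = 3 ^ #|B| * 2 ^ k.
Proof.
move Dn: #|B| => n; elim: n => [|n IHn] in W B Dn *.
  move=> _ _ _ Wk; rewrite mul1n -[k]Wk -(card_powerset W); apply: eq_card => S.
  rewrite !inE; move/eqP: Dn; rewrite cards_eq0 => /eqP->.
  by rewrite andb_idr // => _; apply/forall_inP=> b; rewrite inE.
move=> BW pBW pinj Wk.
have /set0Pn[b bB] : B != set0 by rewrite -card_gt0 Dn.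
have bW := subsetP BW b bB.
have /setDP[aW aB] : p b \in W :\: B by apply: (subsetP pBW); apply: imset_f.
set a := p b in aW aB.
have ab : a != b by apply: contraNneq aB => ->.
pose W' := W :\ b :\ a; pose B' := B :\ b.
pose K := [set S : {set T} | (S \subset W') &&
      [forall x in B', (x \in S) ==> (p x \in S)]].
have cardK : #|K| = 3 ^ n * 2 ^ k.
  apply: IHn.
  - by have := cardsD1 b B; rewrite bB Dn => -[].
  - apply/subsetP=> x; rewrite !inE => /andP[-> xB]; rewrite (subsetP BW) // !andbT.
    by apply: contraNneq aB => <-.
  - apply/subsetP=> _ /imsetP[x /setD1P[xb xB] ->].
    have /setDP[pxW pxB] : p x \in W :\: B by apply: (subsetP pBW); apply: imset_f.
    rewrite !inE pxW andbT; apply/and3P; split.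
    + by rewrite negb_and pxB orbT.
    + by apply: contra_neq xb => /pinj->.
    + by apply: contraNneq pxB => ->.
  - by apply: sub_in2 pinj => x /setD1P[].
  - have := cardsD1 b W; have := cardsD1 a (W :\ b).
    by rewrite !inE aW bW ab -/W'; lia.
have KW S : S \in K -> (a \notin S) && (b \notin S).
  rewrite inE => /andP[/subsetP SW _]; apply/andP; split; apply/negP=> /SW.
    by rewrite !inE eqxx.
  by rewrite !inE eqxx andbF.
(* [i] counts how many of [a, b] are present; [b] never comes without [a]. *)
pose f (i : 'I_3) S := if i == 0 :> nat then S else if i == 1 :> nat then a |: S else a |: (b |: S).
have fE (i : 'I_3) S : S \in K ->
    [/\ a \in f i S = (0 < i), b \in f i S = (1 < i) & f i S :\ b :\ a = S].
  move=> /KW/andP[aS bS]; rewrite /f.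
  case: i => -[|[|[|//]]] ? /=; split; rewrite ?inE ?eqxx ?(negPf aS) ?(negPf bS) ?orbT //=;
    rewrite ?(eq_sym b) ?(negPf ab) //; apply/setP=> x; rewrite !inE;
    (have [->|xa] := eqVneq x a; first by rewrite (negPf aS));
    (have [->|xb] := eqVneq x b; first by rewrite (negPf bS)) => //=.
have -> : [set S : {set T} | (S \subset W) && [forall x in B, (x \in S) ==> (p x \in S)]]
        = [set f u.1 u.2 | u in setX [set: 'I_3] K].
  apply/setP=> S; rewrite inE; apply/andP/imsetP => [[SW Scl]|[[i S'] /setXP[_ S'K] ->] /=].
    have Sba : (b \in S) ==> (a \in S) := forall_inP Scl b bB.
    have SK : S :\ b :\ a \in K.
      rewrite inE; apply/andP; split.
        by apply/setSD/setSD.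
      apply/forall_inP=> x /setD1P[xb xB]; apply/implyP; rewrite !inE => /and3P[xa _ xS].
      rewrite (implyP (forall_inP Scl x xB) xS) andbT; apply/andP; split.
        by apply: contra_neq xb => /pinj->.
      have /setDP[_ pxB] : p x \in W :\: B by apply: (subsetP pBW); apply: imset_f.
      by apply: contraNneq pxB => ->.
    have i3 : (a \in S) + (b \in S) < 3 by case: (a \in S); case: (b \in S).
    exists (Ordinal i3, S :\ b :\ a); first by rewrite !inE; rewrite inE in SK.
    rewrite /f /=; apply/setP=> x; move: Sba.
    case aS: (a \in S); case bS: (b \in S) => //= _; rewrite !inE;
      (have [->|xa] := eqVneq x a; first by rewrite aS ?(negPf ab) ?orbT);
      (have [->|xb] := eqVneq x b; first by rewrite bS); by [].
  have [fa fb fD] := fE i _ S'K; move: (S'K); rewrite inE => /andP[S'W S'cl].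
  have fx x : x != a -> x != b -> (x \in f i S') = (x \in S').
    by move=> xa xb; rewrite -[in RHS]fD !inE xa xb.
  split.
    apply/subsetP=> x; have [->//|xa] := eqVneq x a; have [->//|xb] := eqVneq x b.
    by rewrite fx // => /(subsetP S'W); rewrite !inE => /and3P[].
  apply/forall_inP=> x xB; apply/implyP.
  have [->|xb] := eqVneq x b; first by rewrite fb -/a fa => /ltnW.
  have xa : x != a by apply: contraNneq aB => <-.
  rewrite fx // => xS'; rewrite fx.
  - by apply: (implyP (forall_inP S'cl x _) xS'); rewrite !inE xb.
  - by apply: contra_neq xb => /pinj->.
  - have /setDP[_ pxB] : p x \in W :\: B by apply: (subsetP pBW); apply: imset_f.
    by apply: contraNneq pxB => ->.
rewrite card_in_imset ?cardsX ?cardsT ?card_ord ?cardK; first by rewrite expnS mulnA.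
move=> [i S] [j S'] /setXP[_ /(fE i)[fa fb fD]] /setXP[_ /(fE j)[fa' fb' fD']] /= eqf.
congr pair; last by rewrite -fD -fD' eqf.
apply: val_inj; move: fa fb fa' fb'; rewrite eqf => -> -> /=.
by clear; case: i j => -[|[|[|//]]] ? [[|[|[|//]]] ?].
Qed.

(** * Subtrees through a given vertex, and spiders *)

Section Spiders.
Variable G : sgraph.
Implicit Types (S U W A B : {set G}) (Q : pred {set G}) (b c r x y z : G).
Implicit Types (p m : G -> G) (d : G -> nat).

(** Keeping the side condition [Q] arbitrary lets one recursion serve for all
    subtrees and for those containing a leaf. *)
Definition csets U Q : {set {set G}} :=
  [set S : {set G} | [&& S \subset U, cset S & Q S]].

Definition through r S : bool := r \in S.

Definition has_leaf S : bool := [exists x in S, leaf x].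

Lemma not_leaf x y z : edge x y -> edge x z -> y != z -> ~~ leaf x.
Proof.
move=> xy xz yz; apply/cards1P=> -[w /setP xw].
by have := xw y; have := xw z; rewrite !inE xy xz => /esym/eqP zw /esym/eqP yw;
  rewrite zw yw eqxx in yz.
Qed.

Lemma card_configs U r p B k :
  r \in U -> lowers U r p B -> #|U| = (2 * #|B| + k).+1 ->
  #|configs U r p B| = 3 ^ #|B| * 2 ^ k.
Proof.
move=> rU [BU pBU pinj] Uk.
have Bp b : b \in B -> [/\ b \in U, b != r, p b \in U & p b != r].
  move=> bB; have /setD1P[? ?] := subsetP BU b bB.
  by have /setDP[/setD1P[? ?] _] := subsetP pBU _ (imset_f p bB).
rewrite -(card_closed BU pBU pinj (k := k)); last first.
  by have := cardsD1 r U; rewrite rU Uk add1n => -[].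
rewrite -[RHS](card_in_imset (f := fun S => r |: S)); last first.
  move=> S S'; rewrite !inE => /andP[SU _] /andP[S'U _] /setP eSS'.
  apply/setP=> x; have := eSS' x; rewrite !inE.
  have [->|//] := eqVneq x r; move=> _.
  apply/idP/idP=> [/(subsetP SU)|/(subsetP S'U)]; rewrite !inE eqxx //.
apply: eq_card => S; rewrite inE; apply/and3P/imsetP => [[SU rS SB]|[S' + ->]].
  exists (S :\ r); last by rewrite setD1K.
  rewrite inE setSD //=; apply/forall_inP=> b bB; apply/implyP.
  have [_ br _ pbr] := Bp b bB; rewrite !inE br pbr.
  exact/implyP/(forall_inP SB).
rewrite inE => /andP[S'U S'B]; split; first 1 last.
- by rewrite !inE eqxx.
- apply/forall_inP=> b bB; have [_ br _ pbr] := Bp b bB.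
  by rewrite !inE (negPf br) (negPf pbr); apply: (forall_inP S'B).
- by rewrite subUset sub1set rU; apply: subset_trans S'U _; apply: subD1set.
Qed.

(** A connected set through the root contains the parent of each of its
    vertices, hence meets a matched pair in nothing, in the upper vertex or in
    both. *)
Lemma rooted_configs U r p d B :
  rooted U r p d -> B \subset U :\ r -> csets U (through r) \subset configs U r p B.
Proof.
case=> _ _ _ Ucl BU; apply/subsetP=> S; rewrite !inE => /and3P[SU Sc rS].
rewrite SU (rS : r \in S); apply/forall_inP=> b bB; apply/implyP=> bS.
have /setD1P[br _] := subsetP BU b bB.
exact: Ucl SU Sc rS bS br.
Qed.

(** The set [U] spans a spider: every vertex is joined to the centre [c], except
    the feet, those in [B]; the foot [b] hangs from the knee [p b]. *)
Definition spider U c p B : Prop :=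
  [/\ c \in U, lowers U c p B, {in U :\ c :\: B, forall u, p u = c}
    & {in U &, forall u v,
        edge u v = (u != c) && (p u == v) || (v != c) && (p v == u)}].

(** When the matching covers the root, the partner of [r] is a free vertex, and
    the configurations number exactly [3 ^ q * 2 ^ k.+1]. Otherwise all [q.+1]
    pairs are constrained, and there are only three quarters as many. *)
Lemma card_rooted U r m q k :
  acyclic G -> cset U -> r \in U -> matching_on U m ->
  #|covered U m| = 2 * q.+1 -> #|U| = 2 * q.+1 + k ->
  #|csets U (through r)| <= 3 ^ q * 2 ^ k.+1 /\
  (#|csets U (through r)| = 3 ^ q * 2 ^ k.+1 ->
   exists p B, spider U r p B /\ #|B| = q).
Proof.
move=> Gac Uc rU mU covU Uk.
have [p [d Ur]] := rooted_exists Gac Uc rU.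
have UB := lower_lowers Ur mU; have cardB := card_lower Ur mU covU.
set B := lower U r p m in UB cardB.
have [BU pBU pinj] := UB; have [_ pU eU _] := Ur.
have sub := rooted_configs Ur BU; have le := subset_leq_card sub.
have [mr|mr] := eqVneq (m r) r.
  rewrite mr eqxx addn0 in cardB.
  have kpos : 0 < k.
    have : covered U m \proper U.
      apply/properP; split; first by apply/subsetP=> x; rewrite inE => /andP[].
      by exists r => //; rewrite inE mr eqxx andbF.
    by move/proper_card; rewrite covU Uk; lia.
  suff lt : #|csets U (through r)| < 3 ^ q * 2 ^ k.+1.
    by split; [exact: ltnW | move=> eq; rewrite eq ltnn in lt].
  apply: leq_ltn_trans le _.
  rewrite (card_configs (k := k.-1) rU UB) ?cardB; last by rewrite Uk; lia.
  have := expn_gt0 3 q; have := expn_gt0 2 k.-1.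
  rewrite -(prednK kpos) /= !expnS; nia.
rewrite mr addn1 in cardB; case: cardB => cardB.
have cardC : #|configs U r p B| = 3 ^ q * 2 ^ k.+1.
  by rewrite (card_configs (k := k.+1) rU UB) ?cardB // Uk; lia.
rewrite -cardC; split=> // eqC; exists p, B; split=> //.
have {sub le eqC} allC : csets U (through r) = configs U r p B.
  by apply/eqP; rewrite eqEcard sub eqC leqnn.
split=> // u /setDP[/setD1P[ur uU] uB].
(* The pair [r, u] is a configuration, so equality makes it an edge. *)
have : [set r; u] \in configs U r p B.
  rewrite inE subUset !sub1set rU uU !inE eqxx /=.
  apply/forall_inP=> b bB; apply/implyP; rewrite !inE.
  have /setD1P[/negPf-> _] := subsetP BU b bB.
  by move/eqP=> bu; rewrite -bu bB in uB.
rewrite -allC inE => /and3P[_ ruc _].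
have [v] : exists2 v, v \in [set r; u] & edge u v.
  apply: cset_nbr => //; first by rewrite !inE eqxx orbT.
  by apply: contraNneq ur => /setP/(_ r); rewrite !inE eqxx eq_sym => /esym.
case/set2P=> ->; last by rewrite edge_irr.
by rewrite eU // eqxx ur /= orbF => /eqP.
Qed.

(** An upper vertex has a child and a parent, so it is no leaf: the [2 ^ q]
    configurations made of the root and of upper vertices are lost to the count
    of sets with a leaf. *)
Lemma card_rooted_leaf U r m q :
  acyclic G -> cset U -> r \in U -> matching_on U m ->
  (forall x, x \in U -> m x != x) -> #|U| = 2 * q.+1 -> ~~ leaf r ->
  #|csets U (fun S => (r \in S) && has_leaf S)| + 2 ^ q <= 3 ^ q * 2.
Proof.
move=> Gac Uc rU mU mperf Uq rleaf.
have [p [d Ur]] := rooted_exists Gac Uc rU.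
have covU : #|covered U m| = 2 * q.+1.
  by rewrite -Uq; apply: eq_card => x; rewrite inE andb_idr //; apply: mperf.
have UB := lower_lowers Ur mU; have cardB := card_lower Ur mU covU.
set B := lower U r p m in UB cardB.
rewrite mperf // addn1 in cardB; case: cardB => cardB.
have [BU pBU pinj] := UB; have [_ pU eU _] := Ur.
have Bp b : b \in B -> [/\ b \in U, b != r, p b \in U, p b != r & p b \notin B].
  move=> bB; have /setD1P[? ?] := subsetP BU b bB.
  by have /setDP[/setD1P[? ?] ?] := subsetP pBU _ (imset_f p bB).
pose D := [set r |: A | A in powerset (p @: B)].
have cardD : #|D| = 2 ^ q.
  rewrite card_in_imset ?card_powerset ?(card_in_imset pinj) ?cardB //.
  have rA A : A \subset p @: B -> (r |: A) :\ r = A.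
    move=> ApB; apply: setU1K; apply: contraTN rU => /(subsetP ApB)/imsetP[b bB rpb].
    by have [_ _ _] := Bp b bB; rewrite -rpb eqxx.
  by move=> A A'; rewrite !inE => /rA eA /rA eA' eAA'; rewrite -eA eAA' eA'.
have DC : D \subset configs U r p B.
  apply/subsetP=> _ /imsetP[A + ->]; rewrite !inE eqxx => /subsetP ApB.
  rewrite subUset sub1set rU /=; apply/andP; split.
    by apply/subsetP=> a /ApB/imsetP[b bB ->]; have [] := Bp b bB.
  apply/forall_inP=> b bB; apply/implyP => /setU1P[br|/ApB/imsetP[b' b'B bE]].
    by have [_] := Bp b bB; rewrite br eqxx.
  by have [_ _ _ _] := Bp b' b'B; rewrite -bE bB.
set L := csets _ _.
have LC : L \subset configs U r p B.
  apply: subset_trans (rooted_configs Ur BU); apply/subsetP=> S.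
  by rewrite !inE /through => /and4P[-> -> ->].
have LD : [disjoint L & D].
  rewrite -setI_eq0; apply/eqP/setP=> S; rewrite !inE; apply/negP.
  case/andP=> /and4P[_ _ _ /exists_inP[x xS xleaf]] /imsetP[A + SE].
  rewrite inE => /subsetP ApB; move: xS xleaf; rewrite {}SE => /setU1P[->|/ApB].
    exact/negP.
  case/imsetP=> b bB ->; apply/negP.
  have [bU br pbU pbr pbB] := Bp b bB; have [ppbU dppb] := pU _ pbU pbr.
  have [_ dpb] := pU _ bU br.
  apply: (@not_leaf _ b (p (p b))).
  - by rewrite eU // pbr br eqxx orbT.
  - by rewrite eU // pbr eqxx.
  - by apply: contraTneq dppb => <-; rewrite -leqNgt ltnW.
have := subset_leq_card (_ : L :|: D \subset configs U r p B).
rewrite subUset LC DC cardsU (disjoint_setI0 LD) cards0 subn0 cardD => /(_ isT).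
by rewrite (card_configs (k := 1) rU UB) ?cardB // Uq; lia.
Qed.

(** A connected set through the pendant vertex [x], other than [{x}], stays
    connected without [x] and contains its neighbour [y]. *)
Lemma peel U x y Q :
  (forall v, v \in U -> edge x v -> v = y) ->
  #|csets U Q| <= #|csets (U :\ x) Q| + (Q [set x] +
    #|csets (U :\ x) (fun S => (y \in S) && Q (x |: S))|).
Proof.
move=> xy.
have sub : csets U Q \subset csets (U :\ x) Q :|: ((if Q [set x] then [set [set x]] else set0)
   :|: [set x |: S | S in csets (U :\ x) (fun S => (y \in S) && Q (x |: S))]).
  apply/subsetP=> S; rewrite inE => /and3P[SU Sc QS].
  have [xS|xS] := boolP (x \in S); last first.
    by rewrite !inE subsetD1 SU xS Sc QS.
  have [SE|Sx] := eqVneq S [set x].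
    by rewrite -SE QS !inE eqxx orbT.
  have xyS v : v \in S -> edge x v -> v = y by move=> vS; apply/xy/(subsetP SU).
  have [/setD1P[yx yS] Sxc] := cset_del Sc xS xyS Sx.
  apply/setUP; right; apply/setUP; right; apply/imsetP; exists (S :\ x).
    by rewrite !inE setSD // Sxc yx yS setD1K.
  by rewrite setD1K.
apply: leq_trans (subset_leq_card sub) _.
apply: leq_trans (leq_card_setU _ _) _; rewrite leq_add2l.
apply: leq_trans (leq_card_setU _ _) _; apply: leq_add; last exact: leq_imset_card.
by case: (Q _); rewrite ?cards1 ?cards0.
Qed.

Lemma spider_leaf U c p B x :
  spider U c p B -> x \notin U -> (forall v, v \in U -> edge x v = (v == c)) ->
  spider (x |: U) c [eta p with x |-> c] B.
Proof.
case=> cU [BU pBU pinj] pc eU xU xc.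
have neqx v : v \in U -> (v == x) = false.
  by move=> vU; apply: contraNF xU => /eqP<-.
have Bx b : b \in B -> (b == x) = false.
  by move=> bB; apply: neqx; have /setD1P[] := subsetP BU b bB.
have pU v : v \in U -> v != c -> p v \in U.
  move=> vU vc; have [vB|vB] := boolP (v \in B); last by rewrite pc // !inE vB vc.
  by have /setDP[/setD1P[]] := subsetP pBU _ (imset_f p vB).
split; first by rewrite !inE cU orbT.
- split.
  + by apply: subset_trans BU _; apply/setSD/subsetUr.
  + rewrite (eq_in_imset (g := p)); last by move=> b bB /=; rewrite Bx.
    by apply: subset_trans pBU _; apply/setSD/setSD/subsetUr.
  + by move=> a b aB bB /=; rewrite !Bx //; apply: pinj.
- move=> u; rewrite !inE => /and3P[uB uc /orP[/eqP->|uU]] /=; first by rewrite eqxx.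
  by rewrite neqx // pc // !inE uB uc.
- have xc' : (x == c) = false by rewrite eq_sym neqx.
  have exE v : v \in U -> edge x v = (c == v) || (v != c) && (p v == x).
    move=> vU; rewrite xc // eq_sym; case: (c =P v) => //= /eqP vc.
    by rewrite neqx // pU // eq_sym.
  move=> u v /setU1P[->|uU] /setU1P[->|vU] /=.
  + by rewrite edge_irr eqxx xc' neqx.
  + by rewrite eqxx xc' (neqx v) // exE.
  + by rewrite eqxx xc' edge_sym (neqx u) // exE // orbC.
  + by rewrite (neqx u) // (neqx v) // eU.
Qed.

Lemma spider_foot U c p B x y :
  spider U c p B -> y \in U :\ c :\: B -> y \notin p @: B -> x \notin U ->
  (forall v, v \in U -> edge x v = (v == y)) ->
  spider (x |: U) c [eta p with x |-> y] (x |: B).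
Proof.
case=> cU [BU pBU pinj] pc eU /setDP[/setD1P[yc yU] yB] ypB xU xy.
have neqx v : v \in U -> (v == x) = false.
  by move=> vU; apply: contraNF xU => /eqP<-.
have Bx b : b \in B -> (b == x) = false.
  by move=> bB; apply: neqx; have /setD1P[] := subsetP BU b bB.
have pU v : v \in U -> v != c -> p v \in U.
  move=> vU vc; have [vB|vB] := boolP (v \in B); last by rewrite pc // !inE vB vc.
  by have /setDP[/setD1P[]] := subsetP pBU _ (imset_f p vB).
have xc : (x == c) = false by rewrite eq_sym neqx.
split; first by rewrite !inE cU orbT.
- split.
  + rewrite subUset sub1set !inE eqxx xc /=.
    by apply: subset_trans BU _; apply/setSD/subsetUr.
  + apply/subsetP=> _ /imsetP[b + ->] /= => /setU1P[->|bB].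
      by rewrite eqxx !inE (neqx y) // (negPf yB) yc yU orbT.
    rewrite Bx //; have := subsetP pBU _ (imset_f p bB); rewrite !inE.
    by case/and3P=> /negPf-> -> pbU; rewrite pbU neqx // orbT.
  + have yp b : b \in B -> p b <> y by move=> bB pby; rewrite -pby imset_f in ypB.
    move=> a b /setU1P[->|aB] /setU1P[->|bB] /=; rewrite ?eqxx ?Bx //.
    * by move/esym/yp=> /(_ bB).
    * by move/yp=> /(_ aB).
    * exact: pinj.
- move=> u; rewrite !inE negb_or => /andP[/andP[ux uB] /andP[uc]] /=.
  by rewrite (negPf ux) /= => uU; apply: pc; rewrite !inE uB uc.
- have exE v : v \in U -> edge x v = (y == v) || (v != c) && (p v == x).
    move=> vU; rewrite xy // eq_sym; case: (y =P v) => //= _.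
    by case: (v =P c) => //= /eqP vc; rewrite neqx // pU.
  move=> u v /setU1P[->|uU] /setU1P[->|vU] /=.
  + by rewrite edge_irr eqxx xc neqx.
  + by rewrite eqxx xc (neqx v) // exE.
  + by rewrite eqxx xc edge_sym (neqx u) // exE // orbC.
  + by rewrite (neqx u) // (neqx v) // eU.
Qed.

End Spiders.
Arguments has_leaf {G} S.

(** * Choosing what to remove *)

Section Bounds.
Variable G : sgraph.
Implicit Types (S U W A B : {set G}) (Q : pred {set G}) (b c r v w x y z : G).
Implicit Types (p m : G -> G) (d : G -> nat).

(** Shift the matching downwards: when the unmatched vertex [v] has a child [c]
    matched to [e], which then is a child of [c], matching [v] with [c] frees
    the deeper vertex [e]. *)
Lemma free_leaf U r p d m v :
  rooted U r p d -> cset U -> 1 < #|U| -> matching_on U m -> v \in U -> m v = v ->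
  exists m' x y, [/\ matching_on U m', #|covered U m'| = #|covered U m|,
    x \in U /\ m' x = x, y \in U & {in U, forall w, edge x w = (w == y)}].
Proof.
move=> Ur Uc U1; have [rU pU eU _] := Ur.
(* Depths are bounded, so moving the free vertex down must stop at a leaf. *)
pose N := \max_(u in U) d u.
have dN u : u \in U -> d u <= N by move=> uU; apply: leq_bigmax_cond.
move Dk: (N - d v) => k; elim/ltn_ind: k => k IHk in m v Dk *; move=> mU vU mv.
have [/exists_inP[c cU /andP[cr /eqP pc]]|nochild] :=
    boolP [exists c in U, (c != r) && (p c == v)].
  have [mcU mmc mc] := mU c cU; have [pcU dpc] := pU c cU cr; rewrite pc in pcU dpc.
  have dcN := dN c cU; have [mcc|mcc] := eqVneq (m c) c.
    by apply: (IHk (N - d c)) => //; rewrite -Dk ltn_sub2l // (leq_trans dpc).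
  set e := m c in mcU mmc mc mcc.
  have ev : e != v by apply: contra_neq mcc => ev; rewrite -mmc ev mv.
  have := mc mcc; rewrite eU // cr pc eq_sym (negPf ev) /= => /andP[er /eqP pe].
  have [_] := pU e mcU er; rewrite pe => dce; have deN := dN e mcU.
  have vc : v != c by apply: contraTneq dpc => ->; rewrite ltnn.
  pose m' := [eta m with v |-> c, c |-> v, e |-> e].
  have m'v : m' v = c by rewrite /m' /= eqxx.
  have m'c : m' c = v by rewrite /m' /= (eq_sym c v) (negPf vc) eqxx.
  have m'e : m' e = e by rewrite /m' /= (negPf ev) (negPf mcc) eqxx.
  have m'E u : u != v -> u != c -> u != e -> m' u = m u.
    by rewrite /m' /= => /negPf-> /negPf-> /negPf->.
  have vcE : edge v c by rewrite eU // cr pc eqxx orbT.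
  have mU' : matching_on U m'.
    move=> u uU; have [->|uv] := eqVneq u v; first by rewrite m'v m'c.
    have [->|uc] := eqVneq u c; first by rewrite m'c m'v edge_sym.
    have [->|ue] := eqVneq u e; first by rewrite m'e eqxx.
    rewrite m'E //; have [muU mmu eu] := mU u uU; rewrite m'E //.
    - by apply: contra_neq uv => muv; rewrite -mmu muv mv.
    - by apply: contra_neq ue => muc; rewrite -mmu muc.
    - by apply: contra_neq uc => mue; rewrite -mmu mue mmc.
  have cov : #|covered U m'| = #|covered U m|.
    rewrite (cardsD1 v) (cardsD1 e (covered U m)) !inE vU mcU m'v (eq_sym c) vc.
    rewrite mmc (eq_sym c) mcc; congr (_ + _); apply: eq_card => u; rewrite !inE.
    have [->|uv] := eqVneq u v; first by rewrite mv eqxx !andbF.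
    have [->|ue] := eqVneq u e; first by rewrite m'e eqxx andbF.
    have [->|uc] := eqVneq u c; first by rewrite m'c vc mcc.
    by rewrite m'E.
  have dve := ltn_trans dpc dce.
  rewrite -cov; apply: (IHk (N - d e) _ m' e) => //.
  by rewrite -Dk ltn_sub2l // (leq_trans dve).
have vchild w : w \in U -> w != r -> p w != v.
  by move=> wU wr; have := exists_inPn nochild w wU; rewrite wr.
have vr : v != r.
  apply/eqP => vr; have U1' : U != [set r].
    by apply: contraTneq U1 => ->; rewrite cards1.
  have [w wU] := cset_nbr Uc rU U1'.
  by rewrite eU // eqxx /= -vr => /andP[wv]; rewrite (negPf (vchild w _ _)) // -vr.
have [pvU _] := pU v vU vr.
exists m, v, (p v); split=> // w wU; rewrite eU // vr [in RHS]eq_sym /=.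
by have [_|wr] := eqVneq w r; rewrite /= ?(negPf (vchild w wU wr)) orbF.
Qed.

(** Among the pairs of a perfect matching that avoid the root, take one whose
    upper vertex is deepest: any further child of its two vertices would be the
    upper vertex of a deeper pair. *)
Lemma matched_leg U r p d m :
  rooted U r p d -> matching_on U m -> (forall u, u \in U -> m u != u) ->
  2 < #|U| ->
  exists x y z, [/\ x \in U, y \in U /\ m x = y, z \in U /\ z != x,
    {in U, forall w, edge x w = (w == y)}
    & {in U, forall w, edge y w = (w == x) || (w == z)}].
Proof.
move=> [rU pU eU _] mU mperf U2.
(* Upper vertices of the pairs away from [r]; the deepest of them works. *)
pose Up := [set a in U | [&& a != r, m a != r & p (m a) == a]].
have inUp w : w \in U -> w != r -> m w != r -> p w != m w -> w \in Up.
  move=> wU wr mwr pmw; rewrite inE wU wr mwr /=.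
  have [mwU _ /(_ (mperf w wU))] := mU w wU.
  by rewrite eU // (negPf pmw) mwr andbF.
have [a0 a0Up] : exists a, a \in Up.
  have : 0 < #|U :\ r :\ m r|.
    have := cardsD1 r U; have := cardsD1 (m r) (U :\ r); lia.
  case/card_gt0P=> u; rewrite !inE => /and3P[umr ur uU].
  have [muU mmu _] := mU u uU.
  have mur : m u != r by apply: contra_neq umr => <-.
  have [pmu|pmu] := eqVneq (p u) (m u); last by exists u; apply: inUp.
  exists (m u); apply: inUp; rewrite ?mmu //.
  have [pumU dpu] := pU u uU ur; rewrite pmu in dpu.
  have [_] := pU _ muU mur; apply: contraTneq => ->.
  by rewrite -leqNgt ltnW.
case: (arg_maxnP d a0Up) => a aUp amax.
have := aUp : a \in Up; rewrite inE => /and4P[aU ar mar /eqP pma].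
have [bU mma _] := mU a aU; set b := m a in bU mma mar pma.
have [paU dpa] := pU a aU ar; have [_ dab] := pU b bU mar; rewrite pma in dab.
have ab : a != b by apply: contraTneq dab => <-; rewrite ltnn.
have deeper w : w \in U -> w != r -> m w != r -> p w != m w -> d a < d w -> False.
  move=> wU wr mwr pmw; apply/negP; rewrite -leqNgt; apply: amax.
  exact: inUp.
exists b, a, (p a); split=> //.
- split=> //; apply: contraTneq dpa => ->; rewrite -leqNgt ltnW //.
- move=> w wU; rewrite eU // mar pma eq_sym /=; have [//|wa] := eqVneq w a.
  apply/negP => /andP[wr /eqP pw]; have [_] := pU w wU wr; rewrite pw => dbw.
  have [mwU mmw _] := mU w wU.
  have mwr : m w != r.
    apply/eqP => mwr; have [_ _ /(_ (mperf w wU))] := mU w wU.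
    by rewrite mwr eU // eqxx wr pw (negPf mar).
  apply: (deeper w) => //; last exact: ltn_trans dbw.
  by rewrite pw; apply: contra_neq wa => bmw; rewrite -mmw -bmw.
- move=> w wU; rewrite eU // ar eq_sym orbC /=.
  have [->|wb] := eqVneq w b; first by rewrite mar pma eqxx.
  have [/= ->|_ /=] := eqVneq w (p a); first by rewrite orbT.
  rewrite orbF; apply/negP => /andP[wr /eqP pw]; have [_] := pU w wU wr; rewrite pw => daw.
  have [mwU mmw _] := mU w wU.
  have mwr : m w != r.
    apply/eqP => mwr; have [_ _ /(_ (mperf w wU))] := mU w wU.
    by rewrite mwr eU // eqxx wr pw (negPf ar).
  apply: (deeper w) => //.
  by rewrite pw; apply: contra_neq wb => amw; rewrite -mmw -amw.
Qed.

(** The two reduction steps of the induction. Here [q.+1] is the size of the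
    matching and [k] the number of vertices that it misses. Deleting [x] may leave
    [y] with one neighbour, and deleting [x] and [y] may do so to [z]; they are
    recorded as not being leaves of the whole graph, which keeps the notion of a
    leaf fixed during the induction. *)
Inductive removable U q k : Prop :=
| RemoveLeaf m x y l of k = l.+1 & x \in U & y \in U :\ x
    & {in U, forall w, edge x w = (w == y)} & cset (U :\ x)
    & matching_on (U :\ x) m & #|covered (U :\ x) m| = 2 * q.+1
    & #|U :\ x| = 2 * q.+1 + l & ~~ leaf y
| RemoveLeg m x y z l of q = l.+1 & k = 0 & x \in U & y \in U :\ x
    & z \in U :\ x :\ y
    & {in U, forall w, edge x w = (w == y)}
    & {in U, forall w, edge y w = (w == x) || (w == z)}
    & cset (U :\ x :\ y) & matching_on (U :\ x :\ y) m
    & #|covered (U :\ x :\ y) m| = 2 * q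
    & #|U :\ x :\ y| = 2 * q & ~~ leaf y & ~~ leaf z
    & (forall u, u \in U :\ x :\ y -> m u != u).

Lemma removableP U m q k :
  acyclic G -> cset U -> matching_on U m -> #|covered U m| = 2 * q.+1 ->
  #|U| = 2 * q.+1 + k -> 2 < #|U| -> removable U q k.
Proof.
move=> Gac Uc mU covU Uk U2.
have /set0Pn[r rU] := cset_neq0 Uc.
have [p [d Ur]] := rooted_exists Gac Uc rU.
have not1 W w : 1 < #|W| -> W != [set w] by apply: contraTneq => ->; rewrite cards1.
have [/forall_inP mperf|/forall_inPn[v vU /negbNE/eqP mv]] :=
    boolP [forall u in U, m u != u].
  have k0 : k = 0.
    have : #|covered U m| = #|U|.
      by apply: eq_card => u; rewrite inE andb_idr //; apply: mperf.
    by rewrite covU Uk; lia.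
  rewrite k0 addn0 in Uk.
  case: q => [|l] in covU Uk *; first by rewrite Uk in U2.
  have [x [y [z [xU [yU mxy] [zU zx] xE yE]]]] := matched_leg Ur mU mperf U2.
  have [_ mmx _] := mU x xU; have my : m y = x by rewrite -mxy.
  have yx : y != x by rewrite -mxy mperf.
  have zy : z != y by have := yE y yU; rewrite edge_irr (negPf yx) eq_sym => /esym/negbT.
  have xy1 v : v \in U -> edge x v -> v = y by move=> vU; rewrite xE // => /eqP.
  have [yUx Uxc] := cset_del Uc xU xy1 (not1 _ _ (ltnW U2)).
  have cUx := cardsD1 x U; rewrite xU add1n Uk in cUx.
  have cUxy := cardsD1 y (U :\ x); rewrite yUx in cUxy.
  have yz1 v : v \in U :\ x -> edge y v -> v = z.
    by case/setD1P=> vx vU; rewrite yE // (negPf vx) => /eqP.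
  have Ux1 : 1 < #|U :\ x| by clear -cUx; lia.
  have [zUxy Uxyc] := cset_del Uxc yUx yz1 (not1 _ _ Ux1).
  have mperf' u : u \in U :\ x :\ y -> m u != u.
    by case/setD1P=> _ /setD1P[_]; apply: mperf.
  have Uxy3 : #|U :\ x :\ y| = 2 * l.+1 by clear -cUx cUxy; lia.
  have yzE : edge y z by rewrite yE // eqxx orbT.
  apply: (@RemoveLeg U _ _ m x y z l) => //.
  - apply: (matching_on_sub mU); first by apply/subsetP=> u /setD1P[_ /setD1P[]].
    move=> u /setD1P[uy /setD1P[ux uU]]; have [muU mmu _] := mU u uU.
    rewrite !inE muU andbT; apply/andP; split.
      by apply: contra_neq ux => muy; rewrite -mmu muy.
    by apply: contra_neq uy => mux; rewrite -mmu mux.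
  - by rewrite -Uxy3; apply: eq_card => u; rewrite inE andb_idr //; apply: mperf'.
  - by apply: (not_leaf (y := x) _ yzE); [rewrite yE // eqxx | rewrite eq_sym].
  - have Uxy1 : 1 < #|U :\ x :\ y| by rewrite Uxy3; clear; lia.
    have [w wUxy zw] := cset_nbr Uxyc zUxy (not1 _ z Uxy1).
    apply: (@not_leaf _ z y w) => //; first by rewrite edge_sym.
    by apply: contraTneq wUxy => <-; rewrite !inE eqxx.
have [m' [x [y [mU' cov' [xU m'x] yU xE]]]] := free_leaf Ur Uc (ltnW U2) mU vU mv.
have xy1 w : w \in U -> edge x w -> w = y by move=> wU; rewrite xE // => /eqP.
have [yUx Uxc] := cset_del Uc xU xy1 (not1 _ _ (ltnW U2)).
have cUx := cardsD1 x U; rewrite xU in cUx.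
have covx : #|covered (U :\ x) m'| = 2 * q.+1.
  rewrite -covU -cov'; apply: eq_card => u; rewrite !inE.
  have [->|ux] := eqVneq u x; first by rewrite m'x eqxx !andbF.
  by [].
have kpos : 0 < k.
  have : covered (U :\ x) m' \subset U :\ x by apply/subsetP=> u; rewrite inE => /andP[].
  by move/subset_leq_card; rewrite covx; clear -cUx Uk; lia.
apply: (@RemoveLeaf U _ _ m' x y k.-1) => //.
- by rewrite prednK.
- apply: (matching_on_sub mU' (subD1set U x)) => u /setD1P[ux uU].
  have [muU mmu _] := mU' u uU; rewrite !inE muU andbT.
  by apply: contra_neq ux => mux; rewrite -mmu mux m'x.
- by clear -cUx Uk kpos; lia.
- have Ux1 : 1 < #|U :\ x| by clear -cUx U2; lia.
  have [w wUx yw] := cset_nbr Uxc yUx (not1 _ y Ux1).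
  apply: (@not_leaf _ y x w) => //; first by rewrite edge_sym xE.
  by apply: contraTneq wUx => <-; rewrite !inE eqxx.
Qed.

Lemma peel_leaf U x y Q :
  {in U, forall w, edge x w = (w == y)} ->
  #|csets U Q| <=
    #|csets (U :\ x) Q| + (Q [set x] + #|csets (U :\ x) (through y)|).
Proof.
move=> xE; have xy v : v \in U -> edge x v -> v = y.
  by move=> vU; rewrite xE // => /eqP.
apply: leq_trans (peel Q xy) _; rewrite !leq_add2l; apply/subset_leq_card/subsetP=> S.
by rewrite !inE => /and4P[-> -> ? _].
Qed.

(** The last three terms count the sets through [x] and through [y]: the
    sets [{x, y}], those containing [x] and [z], and those containing [y] and [z]
    but not [x]. *)
Lemma peel_leg U x y z Q :
  y \in U :\ x ->
  {in U, forall w, edge x w = (w == y)} ->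
  {in U, forall w, edge y w = (w == x) || (w == z)} ->
  #|csets U Q| <= #|csets (U :\ x :\ y) Q| + Q [set x] + Q [set y] + 1 +
    #|csets (U :\ x :\ y) (through z)| +
    #|csets (U :\ x :\ y) (fun S => (z \in S) && Q (y |: S))|.
Proof.
move=> yUx xE yE.
have yz v : v \in U :\ x -> edge y v -> v = z.
  by case/setD1P=> vx vU; rewrite yE // (negPf vx) => /eqP.
have := peel_leaf Q xE; have := peel Q yz; have := peel (through y) yz.
have -> : csets (U :\ x :\ y) (through y) = set0.
  by apply/setP=> S; rewrite !inE /through subsetD1; case: (y \in S); rewrite ?andbF.
have -> : csets (U :\ x :\ y) (fun S => (z \in S) && through y (y |: S))
        = csets (U :\ x :\ y) (through z).
  by apply/setP=> S; rewrite !inE /through setU11 andbT.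
by rewrite cards0 /through set11; clear; lia.
Qed.

(** * The two upper bounds *)

Lemma spider_ext_leaf U c p B x : x \in U ->
  spider (U :\ x) c p B -> {in U, forall w, edge x w = (w == c)} ->
  exists p', spider U c p' B.
Proof.
move=> xU sp xE; exists [eta p with x |-> c]; rewrite -(setD1K xU).
apply: spider_leaf sp _ _; first by rewrite !inE eqxx.
by move=> v /setD1P[_]; apply: xE.
Qed.

Lemma spider_ext_leg U c p B x y : x \in U -> y \in U :\ x ->
  spider (U :\ x :\ y) c p B -> {in U, forall w, edge x w = (w == y)} ->
  {in U, forall w, edge y w = (w == x) || (w == c)} ->
  exists p', spider U c p' (x |: B).
Proof.
move=> xU yU sp xE yE; have [/setD1P[cy _] [BU pBU _] _ _] := sp.
have [p' sp'] : exists p', spider (U :\ x) c p' B.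
  apply: (spider_ext_leaf yU sp) => w /setD1P[wx wU]; by rewrite yE // (negPf wx).
have [_ [_ _ _] pc _] := sp'; have /setD1P[yx yU'] := yU.
have yB : y \notin B by apply/negP=> /(subsetP BU); rewrite !inE eqxx !andbF.
have [/setD1P[cx cU] [BU' pBU' _] _ eU] := sp'.
exists [eta p' with x |-> y]; rewrite -(setD1K xU).
apply: (spider_foot sp'); rewrite ?inE ?eqxx //.
- by rewrite yB eq_sym cy yx yU'.
- apply/imsetP=> -[b bB yb].
  have /setD1P[bc bU] := subsetP BU' b bB.
  have : edge y b by rewrite eU // bc -yb eqxx orbT.
  have /setD1P[bx bU'] := bU; rewrite yE // (negPf bx) (negPf bc) //.
- by move=> v /setD1P[_]; apply: xE.
Qed.

Lemma card2_spider U : cset U -> #|U| = 2 -> exists c p, spider U c p set0.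
Proof.
move=> Uc /eqP/cards2P[a [b [ab UE]]].
have aU : a \in U by rewrite UE !inE eqxx.
have bU : b \in U by rewrite UE !inE eqxx orbT.
have [] := @cset_nbr _ U a Uc aU.
  by apply: contraNneq ab => /setP/(_ b); rewrite bU inE eq_sym => /esym.
move=> w; rewrite UE => /set2P[->|->] wE; first by rewrite edge_irr in wE.
exists a, (fun=> a); split; first by rewrite !inE eqxx.
- split; rewrite ?sub0set ?imset0 ?sub0set // => x; by rewrite inE.
- by [].
- move=> u v /set2P[]-> /set2P[]->;
    rewrite ?edge_irr ?eqxx /= ?(eq_sym b) ?(negPf ab) ?wE //.
  by rewrite edge_sym wE.
Qed.

Lemma csetsT U : csets U predT \subset powerset U :\ set0.
Proof.
by apply/subsetP=> S; rewrite !inE => /and3P[-> /cset_neq0-> _].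
Qed.

(** The bound is [2 ^ (n - 2Q + 1) * 3 ^ (Q - 1) + n + Q - 2] at [Q = q.+1] and
    [n = 2Q + k]. *)
Lemma card_csets U m q k :
  acyclic G -> cset U -> matching_on U m -> #|covered U m| = 2 * q.+1 ->
  #|U| = 2 * q.+1 + k ->
  #|csets U predT| <= 3 ^ q * 2 ^ k.+1 + 3 * q + k + 1 /\
  (#|csets U predT| = 3 ^ q * 2 ^ k.+1 + 3 * q + k + 1 ->
   exists c p B, spider U c p B /\ #|B| = q).
Proof.
move=> Gac.
move Dn: #|U| => n; elim/ltn_ind: n => n IHn in U m q k Dn *.
move=> Uc mU covU Un.
have [n2|n2] := leqP n 2.
  have [U2 q0 k0] : [/\ #|U| = 2, q = 0 & k = 0] by clear -Dn Un n2; split; lia.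
  rewrite q0 k0; split; last first.
    have [c [p sp]] := card2_spider Uc U2.
    by exists c, p, set0; rewrite cards0.
  apply: leq_trans (subset_leq_card (csetsT U)) _.
  by have := cardsD1 set0 (powerset U); rewrite card_powerset U2 inE sub0set add1n => -[<-].
rewrite -Dn in n2 Un.
case: (removableP Gac Uc mU covU Un n2).
- move=> m' x y l kl xU yUx xE Uxc mU' cov' Ux yl.
  have pe := peel_leaf predT xE.
  have lt : #|U :\ x| < n by rewrite -Dn (cardsD1 x U) xU.
  have [IH _] := IHn _ lt _ m' q l erefl Uxc mU' cov' Ux.
  have [R Req] := card_rooted Gac Uxc yUx mU' cov' Ux.
  rewrite kl.
  move: R Req IH pe; rewrite !expnS.
  set R := #|csets _ (through y)| => R1 Req IH pe.
  split; first by clear -R1 IH pe; lia.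
  move=> eq; have [|p [B [sp cB]]] := Req; first by clear -R1 IH pe eq; lia.
  by have [p' sp'] := spider_ext_leaf xU sp xE; exists y, p', B.
move=> m' x y z l ql k0 xU yUx zUxy xE yE Uxyc mU' cov' Uxy yl zl mperf'.
have pe := peel_leg predT yUx xE yE.
have lt : #|U :\ x :\ y| < n.
  by rewrite -Dn (cardsD1 x U) xU (cardsD1 y (U :\ x)) yUx ltnS leqW.
have Uxy' : #|U :\ x :\ y| = 2 * l.+1 + 0 by rewrite addn0 -ql.
rewrite ql in cov'.
have [IH _] := IHn _ lt _ m' l 0 erefl Uxyc mU' cov' Uxy'.
have [R Req] := card_rooted Gac Uxyc zUxy mU' cov' Uxy'.
have RE : csets (U :\ x :\ y) (fun S => (z \in S) && predT (y |: S)) = csets (U :\ x :\ y) (through z).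
  by apply/setP=> S; rewrite !inE andbT.
rewrite RE in pe; rewrite ql k0; move: R Req IH pe; rewrite !expnS.
set R := #|csets _ (through z)| => R1 Req IH pe.
split; first by clear -R1 IH pe; lia.
move=> eq; have [|p [B [sp cB]]] := Req; first by clear -R1 IH pe eq; lia.
have [p' sp'] := spider_ext_leg xU yUx sp xE yE; exists z, p', (x |: B); split=> //.
rewrite cardsU1 cB; case: sp => _ [/subsetP BU _ _] _ _.
by case: (boolP (x \in B)) => // /BU; rewrite !inE eqxx !andbF.
Qed.

(** A single edge whose two ends both count as leaves violates the bound. The
    hypothesis that some vertex of [U] is not a leaf of [G] excludes it, and
    both reduction steps preserve this hypothesis. *)
Lemma card_csets_leaf U m q k :
  acyclic G -> cset U -> matching_on U m -> #|covered U m| = 2 * q.+1 ->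
  #|U| = 2 * q.+1 + k -> (exists2 v, v \in U & ~~ leaf v) ->
  #|csets U has_leaf| + 2 ^ q <= 3 ^ q * 2 ^ k.+1 + 2 * q + k + 1 /\
  (#|csets U has_leaf| + 2 ^ q = 3 ^ q * 2 ^ k.+1 + 2 * q + k + 1 ->
   exists c p B, spider U c p B /\ #|B| = q).
Proof.
move=> Gac.
move Dn: #|U| => n; elim/ltn_ind: n => n IHn in U m q k Dn *.
move=> Uc mU covU Un nl.
have [n2|n2] := leqP n 2.
  have [U2 q0 k0] : [/\ #|U| = 2, q = 0 & k = 0] by clear -Dn Un n2; split; lia.
  rewrite q0 k0; split; last first.
    have [c [p sp]] := card2_spider Uc U2.
    by exists c, p, set0; rewrite cards0.
  have [v vU vl] := nl.
  have sub : csets U has_leaf \subset powerset U :\ set0 :\ [set v].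
    apply/subsetP=> S SU; rewrite !inE; move: SU;
      rewrite inE => /and3P[-> /cset_neq0-> /exists_inP[w wS wl]].
    by rewrite !andbT; apply: contraNneq vl => SE; move: wS; rewrite SE => /set1P<-.
  have v0 : [set v] != set0 by apply/set0Pn; exists v; rewrite inE.
  have := subset_leq_card sub.
  have := cardsD1 [set v] (powerset U :\ set0); have := cardsD1 set0 (powerset U).
  rewrite card_powerset U2 !inE sub0set v0 sub1set vU; clear.
  by rewrite expn0 !expn1 !add1n => -[<-] -[<-] le2; rewrite addn1 ltnS.
rewrite -Dn in n2 Un.
case: (removableP Gac Uc mU covU Un n2).
- move=> m' x y l kl xU yUx xE Uxc mU' cov' Ux yl.
  have pe := peel_leaf has_leaf xE.
  have lt : #|U :\ x| < n by rewrite -Dn (cardsD1 x U) xU.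
  have nl' : exists2 v, v \in U :\ x & ~~ leaf v by exists y.
  have [IH _] := IHn _ lt _ m' q l erefl Uxc mU' cov' Ux nl'.
  have [R Req] := card_rooted Gac Uxc yUx mU' cov' Ux.
  rewrite kl; move: R Req IH pe; rewrite !expnS.
  set R := #|csets _ (through y)| => R1 Req IH pe.
  have := leq_b1 (has_leaf [set x]) => b1.
  split; first by clear -R1 IH pe b1; lia.
  move=> eq; have [|p [B [sp cB]]] := Req; first by clear -R1 IH pe b1 eq; lia.
  by have [p' sp'] := spider_ext_leaf xU sp xE; exists y, p', B.
move=> m' x y z l ql k0 xU yUx zUxy xE yE Uxyc mU' cov' Uxy yl zl mperf'.
have pe := peel_leg has_leaf yUx xE yE.
have lt : #|U :\ x :\ y| < n.
  by rewrite -Dn (cardsD1 x U) xU (cardsD1 y (U :\ x)) yUx ltnS leqW.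
have nl' : exists2 v, v \in U :\ x :\ y & ~~ leaf v by exists z.
have Uxy' : #|U :\ x :\ y| = 2 * l.+1 + 0 by rewrite addn0 -ql.
rewrite ql in cov' Uxy.
have [IH _] := IHn _ lt _ m' l 0 erefl Uxyc mU' cov' Uxy' nl'.
have [R Req] := card_rooted Gac Uxyc zUxy mU' cov' Uxy'.
have RL := card_rooted_leaf Gac Uxyc zUxy mU' mperf' Uxy zl.
have RE : csets (U :\ x :\ y) (fun S => (z \in S) && has_leaf (y |: S))
  = csets (U :\ x :\ y) (fun S => (z \in S) && has_leaf S).
  apply/setP=> S; rewrite !inE; do 3![congr andb].
  apply/exists_inP/exists_inP=> -[w wS wl]; exists w => //; last by rewrite !inE wS orbT.
  by case/setU1P: wS => // wy; rewrite -wy wl in yl.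
have y0 : has_leaf [set y] = false.
  by apply/negbTE/exists_inPn=> w /set1P->.
rewrite RE y0 in pe; have := leq_b1 (has_leaf [set x]) => b1.
rewrite ql k0; move: R Req IH pe RL; rewrite !expnS.
set R := #|csets _ (through z)| => R1 Req IH pe RL.
split; first by clear -R1 IH pe RL b1; lia.
move=> eq; have [|p [B [sp cB]]] := Req; first by clear -R1 IH pe RL b1 eq; lia.
have [p' sp'] := spider_ext_leg xU yUx sp xE yE; exists z, p', (x |: B); split=> //.
rewrite cardsU1 cB; case: sp => _ [/subsetP BU _ _] _ _.
by case: (boolP (x \in B)) => // /BU; rewrite !inE eqxx !andbF.
Qed.

End Bounds.

(** * Spiders attain the bounds *)

Section WholeSpider.
Variables (G : sgraph) (c : G) (p : G -> G) (B : {set G}).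
Hypothesis sp : spider [set: G] c p B.
Implicit Types (S A : {set G}) (Q : pred {set G}).

Lemma spider_edge u v :
  edge u v = (u != c) && (p u == v) || (v != c) && (p v == u).
Proof. by have [_ _ _ ->] := sp. Qed.

Lemma spider_body u : u != c -> u \notin B -> p u = c.
Proof. by move=> uc uB; have [_ _ pc _] := sp; rewrite pc // !inE uB uc. Qed.

Lemma spider_legs b : b \in B -> [/\ b != c, p b != c & p b \notin B].
Proof.
have [_ [/subsetP BU /subsetP pBU _] _ _] := sp; move=> bB.
by have := BU b bB; have := pBU _ (imset_f p bB); rewrite !inE !andbT => /andP[-> ->] ->.
Qed.

Lemma spider_pinj : {in B &, injective p}.
Proof. by have [_ []] := sp. Qed.

Lemma spider_up u : u != c -> edge u (p u).
Proof. by rewrite spider_edge eqxx => ->. Qed.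

Lemma spider_centre u : u != c -> u \notin B -> edge u c.
Proof. by move=> uc uB; rewrite -[in X in edge _ X](spider_body uc uB) spider_up. Qed.

Lemma spider_config_cset S :
  c \in S -> (forall b, b \in B -> b \in S -> p b \in S) -> cset S.
Proof.
move=> cS Scl; apply: (cset_star cS) => u uS.
have up v : v \in S -> v != c -> v \notin B -> connect (within S) v c.
  by move=> vS vc vB; apply: connect1; rewrite /within vS cS spider_centre.
have [->|uc] := eqVneq u c; first exact: connect0.
have [uB|uB] := boolP (u \in B); last exact: up.
have [_ pc pB] := spider_legs uB; apply: connect_trans (up _ (Scl u uB uS) pc pB).
by apply: connect1; rewrite /within uS Scl ?spider_up.
Qed.

(** A vertex of largest depth in a cycle would have two distinct neighbours of
    no larger depth, but only its parent qualifies. *)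
Lemma spider_tree : tree G.
Proof.
split.
  have /csetP[_ Gc] : cset [set: G].
    by apply: spider_config_cset => *; rewrite inE.
  apply/andP; split; first by apply/card_gt0P; exists c.
  apply/forallP=> x; apply/forallP=> y.
  have := Gc x y (in_setT _) (in_setT _).
  by apply: (connect_map (f := id)) => u v /and3P[].
pose d u := if u == c then 0 else if u \in B then 2 else 1.
have dp u : u != c -> d (p u) < d u.
  move=> uc; rewrite /d (negPf uc); have [uB|uB] := boolP (u \in B).
    by have [_ /negPf-> /negPf->] := spider_legs uB.
  by rewrite (spider_body uc uB) eqxx.
move=> s s2 /andP[cyc us].
have [x0 x0s] : exists x0, x0 \in s by case: s s2 {cyc us} => // x s; exists x;
  rewrite inE eqxx.
case: (arg_maxnP (P := mem s) d x0s) => x xs xmax.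
have [i s' rs] := rot_to xs.
have : ucycle edge (x :: s') by rewrite -rs /ucycle rot_cycle rot_uniq cyc us.
have s'2 : 1 < size s' by move: s2; rewrite -(size_rot i) rs.
have inx y : y \in s' -> d y <= d x.
  by move=> ys; apply: (xmax y : y \in s -> _); rewrite -(mem_rot i) rs inE ys orbT.
have toparent y : y \in s' -> edge x y -> y = p x.
  move=> /inx dy; rewrite spider_edge => /orP[/andP[_ /eqP//]|/andP[yc /eqP pyx]].
  by have := dp y yc; rewrite pyx ltnNge dy.
case/lastP: s' s'2 inx toparent {rs} => [//|s' z]; case: s' => [//|y s'] _ inx toparent.
rewrite /ucycle /= !rcons_path last_rcons => /andP[/andP[xy /andP[_ zx]]].
have -> : y = p x by apply: toparent; rewrite // inE eqxx.
have -> : z = p x.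
  by apply: toparent; rewrite ?(edge_sym x) // mem_rcons !inE eqxx.
by rewrite mem_rcons inE eqxx !andbF.
Qed.

Lemma spider_leafP w : w != c -> w \notin p @: B -> leaf w.
Proof.
move=> wc wpB; apply/cards1P; exists (p w); apply/setP=> y; rewrite !inE.
rewrite spider_edge wc eq_sym /= orb_idr // => /andP[yc /eqP pyw].
case: (boolP (y \in B)) => [yB|yB].
  by case/negP: wpB; rewrite -pyw imset_f.
by rewrite -pyw (spider_body yc yB) eqxx in wc.
Qed.

Definition singles A : {set {set G}} := [set [set u] | u in A].
Definition legs : {set {set G}} := [set [set b; p b] | b in B].

Lemma singles_csets A Q : (forall u, u \in A -> Q [set u]) ->
  singles A \subset csets [set: G] Q.
Proof.
move=> QA; apply/subsetP=> _ /imsetP[u uA ->].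
by rewrite inE subsetT cset1 QA.
Qed.

Lemma legs_csets (Q : pred {set G}) :
  (forall b, b \in B -> Q [set b; p b]) -> legs \subset csets [set: G] Q.
Proof.
move=> QB; apply/subsetP=> _ /imsetP[b bB ->]; rewrite inE subsetT QB // andbT /=.
by apply: cset2; apply: spider_up; case: (spider_legs bB).
Qed.

(** A family of connected sets through the centre is disjoint from the single
    vertices and the edges that miss it. *)
Lemma card_off_centre A (C : {set {set G}}) (Q : pred {set G}) :
  c \notin A -> C \subset csets [set: G] Q -> (forall S, S \in C -> c \in S) ->
  (forall u, u \in A -> Q [set u]) -> (forall b, b \in B -> Q [set b; p b]) ->
  #|C| + #|A| + #|B| <= #|csets [set: G] Q|.
Proof.
move=> cA CQ Cc QA QB.
have cs : #|singles A| = #|A| by apply: card_imset; apply: set1_inj.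
have cl : #|legs| = #|B|.
  apply: card_in_imset => a b aB bB /setP/(_ a);
    rewrite !inE eqxx /= => /esym/orP[/eqP//|/eqP apb].
  by have [_ _] := spider_legs bB; rewrite -apb aB.
have d1 : [disjoint C & singles A].
  rewrite -setI_eq0; apply/eqP/setP=> S; rewrite !inE; apply/negP.
  case/andP=> /Cc cS /imsetP[u uA SE]; move: cS; rewrite SE inE => /eqP cu.
  by rewrite cu uA in cA.
have d2 : [disjoint C :|: singles A & legs].
  rewrite -setI_eq0; apply/eqP/setP=> S; rewrite !inE; apply/negP.
  case/andP=> CA /imsetP[b bB SE]; have [bc pbc pbB] := spider_legs bB.
  case/orP: CA => [/Cc|/imsetP[u uA]].
    by rewrite SE !inE ![c == _]eq_sym (negPf bc) (negPf pbc).
  rewrite SE => /setP E; have := E b; have := E (p b); rewrite !inE !eqxx orbT /=.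
  by move=> /esym/eqP pbu /esym/eqP bu; rewrite pbu -bu bB in pbB.
rewrite -cs -cl.
apply: leq_trans (subset_leq_card (_ : C :|: singles A :|: legs \subset _)).
  by rewrite !cardsU (disjoint_setI0 d1) (disjoint_setI0 d2) !cards0 !subn0.
by rewrite !subUset CQ singles_csets // legs_csets.
Qed.

Lemma spider_card_csets q k :
  #|B| = q -> #|G| = 2 * q.+1 + k ->
  3 ^ q * 2 ^ k.+1 + 3 * q + k + 1 <= #|csets [set: G] predT|.
Proof.
move=> Bq Gk; have [_ Bl _ _] := sp.
have cC : #|configs [set: G] c p B| = 3 ^ q * 2 ^ k.+1.
  by rewrite (card_configs (k := k.+1) _ Bl) ?Bq // cardsT Gk; clear; lia.
have cA : #|[set: G] :\ c| = 2 * q + k + 1.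
  by have := cardsD1 c [set: G]; rewrite cardsT in_setT Gk; clear; lia.
have := @card_off_centre ([set: G] :\ c) (configs [set: G] c p B) predT.
rewrite cC cA Bq => H; apply: leq_trans (H _ _ _ _ _) => //.
- by clear; lia.
- by rewrite !inE eqxx.
- apply/subsetP=> S; rewrite !inE => /and3P[_ cS /forall_inP Scl].
  rewrite subsetT /= andbT; apply: spider_config_cset => // b bB bS.
  exact: (implyP (Scl b bB)).
- by move=> S; rewrite inE => /and3P[].
Qed.

Lemma spider_card_csets_leaf q k :
  #|B| = q -> #|G| = 2 * q.+1 + k ->
  3 ^ q * 2 ^ k.+1 + 2 * q + k + 1 <= #|csets [set: G] has_leaf| + 2 ^ q.
Proof.
move=> Bq Gk; have [_ Bl _ _] := sp.
have cC : #|configs [set: G] c p B| = 3 ^ q * 2 ^ k.+1.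
  by rewrite (card_configs (k := k.+1) _ Bl) ?Bq // cardsT Gk; clear; lia.
have cpB : #|p @: B| = q by rewrite (card_in_imset spider_pinj).
pose A := [set: G] :\ c :\: p @: B.
have cA : #|A| = q + k + 1.
  have := cardsD1 c [set: G]; rewrite cardsT in_setT Gk.
  have := cardsID (p @: B) ([set: G] :\ c).
  rewrite (setIidPr _); last first.
    apply/subsetP=> _ /imsetP[b bB ->]; have [_ pc _] := spider_legs bB.
    by rewrite !inE pc.
  by rewrite cpB -/A; clear; lia.
have leafA u : u \in A -> leaf u.
  by case/setDP=> /setD1P[uc _]; apply: spider_leafP.
(* The configurations without a leaf consist of the centre and of knees. *)
pose D := [set c |: K | K in powerset (p @: B)].
have cD : #|D| <= 2 ^ q.
  by apply: leq_trans (leq_imset_card _ _) _; rewrite card_powerset cpB.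
have := @card_off_centre A (configs [set: G] c p B :\: D) has_leaf.
rewrite cA Bq => H.
suff : #|configs [set: G] c p B :\: D| + (q + k + 1) + q <= #|csets [set: G] has_leaf|.
  have : 3 ^ q * 2 ^ k.+1 <= #|configs [set: G] c p B :\: D| + 2 ^ q.
    rewrite -cC -(cardsID D (configs [set: G] c p B)) addnC leq_add2l.
    by apply: leq_trans cD; rewrite subset_leq_card ?subsetIr.
  by clear; lia.
apply: H.
- by rewrite !inE eqxx andbF.
- apply/subsetP=> S /setDP[]; rewrite !inE => /and3P[_ cS /forall_inP Scl] SD.
  rewrite subsetT /=; apply/andP; split.
    by apply: spider_config_cset => // b bB bS; apply: (implyP (Scl b bB)).
  have : ~~ (S :\ c \subset p @: B).
    apply: contra SD => ScB; apply/imsetP; exists (S :\ c); first by rewrite inE.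
    by rewrite setD1K.
  case/subsetPn=> w /setD1P[wc wS] wpB; apply/exists_inP; exists w => //.
  exact: spider_leafP.
- by move=> S /setDP[+ _]; rewrite inE => /and3P[].
- by move=> u uA; apply/exists_inP; exists u; [rewrite inE | apply: leafA].
- move=> b bB; have [bc pc pB] := spider_legs bB.
  apply/exists_inP; exists b; first by rewrite !inE eqxx.
  by apply: spider_leafP => //; apply/imsetP=> -[a aB ba]; have [_ _] := spider_legs aB;
    rewrite -ba bB.
Qed.

End WholeSpider.

(** * Matchings *)

Section Matchings.
Variable G : sgraph.
Implicit Types (M : {set {set G}}) (B C : {set G}) (p : G -> G).

Lemma matching_edge M e : matching M -> e \in M ->
  exists x y, edge x y /\ e = [set x; y].
Proof.
case/andP=> /subsetP ME _ /ME; rewrite inE => /existsP[x /existsP[y /andP[xy /eqP->]]].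
by exists x, y.
Qed.

Lemma matching_number_attained :
  exists2 M : {set {set G}}, matching M & #|M| = matching_number G.
Proof.
have m0 : matching (set0 : {set {set G}}).
  by rewrite /matching sub0set; apply/trivIsetP=> A A'; rewrite inE.
rewrite /matching_number (bigmax_eq_arg set0) //.
by case: arg_maxnP => // M ? _; exists M.
Qed.

Lemma matching_involution M : matching M ->
  exists m, matching_on [set: G] m /\ #|covered [set: G] m| = 2 * #|M|.
Proof.
move=> matM; have /andP[_ tM] := matM.
pose m x := odflt x [pick y in pblock M x :\ x].
have mK x y : edge x y -> [set x; y] \in M -> m x = y.
  move=> xy eM; rewrite /m (def_pblock tM eM) ?inE ?eqxx //.
  case: pickP => [z|/(_ y)]; rewrite !inE; first by case/andP=> /negPf-> /eqP.
  by rewrite eqxx orbT andbT => /negbFE/eqP yx; rewrite yx edge_irr in xy.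
have mcov x : x \in cover M -> edge x (m x) /\ [set x; m x] \in M.
  move=> /bigcupP[e eM xe]; have [a [b [ab eE]]] := matching_edge matM eM.
  subst e; case/set2P: xe => ->; first by rewrite (mK _ _ ab eM).
  rewrite setUC in eM; rewrite edge_sym in ab; by rewrite (mK _ _ ab eM).
have mout x : x \notin cover M -> m x = x.
  move=> xM; rewrite /m; case: pickP => // z /setD1P[_ zx].
  by rewrite /pblock in zx; case: pickP zx => [e /andP[eM xe]|_]; [case/negP: xM;
    apply/bigcupP; exists e | rewrite inE].
exists m; split.
  move=> x _; have [xM|xM] := boolP (x \in cover M); last by rewrite !mout // eqxx; split.
  have [xmx eM] := mcov x xM; split=> //.
  by apply: mK; rewrite 1?edge_sym // setUC.
have -> : covered [set: G] m = cover M.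
  apply/setP=> x; rewrite !inE /=; apply/idP/idP=> [|/mcov[xmx _]].
    by apply: contraR => /mout->.
  by apply: contraTneq xmx => ->; rewrite edge_irr.
move: tM; rewrite /trivIset => /eqP <-.
have e2 e : e \in M -> #|e| = 2; last first.
  by rewrite (eq_bigr _ e2) sum_nat_const mulnC.
move=> eM; have [a [b [ab ->]]] := matching_edge matM eM.
by rewrite cards2; case: eqP ab => // ->; rewrite edge_irr.
Qed.

(** Disjoint edges need distinct vertices to cover them. *)
Lemma matching_number_cover C :
  (forall x y, edge x y -> (x \in C) || (y \in C)) -> matching_number G <= #|C|.
Proof.
move=> Ccov; apply/bigmax_leqP=> M matM; have /andP[_ tM] := matM.
apply: leq_trans (leq_imset_card (pblock M) C); apply/subset_leq_card/subsetP=> e eM.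
have [x [y [xy eE]]] := matching_edge matM eM.
have [z zC ze] : exists2 z, z \in C & z \in e.
  by case/orP: (Ccov x y xy) => ?; [exists x | exists y]; rewrite // eE !inE eqxx ?orbT.
by apply/imsetP; exists z => //; rewrite (def_pblock tM eM ze).
Qed.

Lemma matching_number_ge B p :
  {in B &, injective p} -> {in B, forall b, edge b (p b) /\ p b \notin B} ->
  #|B| <= matching_number G.
Proof.
move=> pinj pB; pose M := [set [set b; p b] | b in B].
have eqM a b : a \in B -> b \in B -> ~~ [disjoint [set a; p a] & [set b; p b]] -> a = b.
  move=> aB bB; rewrite -setI_eq0 => /set0Pn[x]; rewrite !inE.
  case/andP=> /orP[]/eqP-> /orP[]/eqP // E; last exact: pinj.
  - by have [_] := pB b bB; rewrite -E aB.
  - by have [_] := pB a aB; rewrite E bB.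
have <- : #|M| = #|B|.
  apply: card_in_imset => a b aB bB E; apply: eqM => //; rewrite -E -setI_eq0 setIid.
  by apply/set0Pn; exists a; rewrite !inE eqxx.
apply: leq_bigmax_cond; apply/andP; split.
  apply/subsetP=> _ /imsetP[b bB ->]; rewrite inE.
  by apply/existsP; exists b; apply/existsP; exists (p b); have [-> _] := pB b bB;
    rewrite eqxx.
apply/trivIsetP=> _ _ /imsetP[a aB ->] /imsetP[b bB ->]; apply: contraR.
by move/(eqM a b aB bB)->.
Qed.

(** The centre and the knees cover all edges. For a matching of that size, join
    each foot to its knee and the centre to one more vertex [w], neither foot nor
    knee; counting shows that there is one. *)
Lemma spider_matching_number c p B :
  spider [set: G] c p B -> 2 * #|B|.+1 <= #|G| -> matching_number G = #|B|.+1.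
Proof.
move=> sp GB; have pinj := spider_pinj sp; apply/eqP; rewrite eqn_leq; apply/andP; split.
  apply: leq_trans (matching_number_cover (C := c |: p @: B) _) _.
    have up u v : u != c -> p u = v -> v \in c |: p @: B.
      move=> uc <-; rewrite !inE; have [uB|uB] := boolP (u \in B).
        by rewrite imset_f ?orbT.
      by rewrite (spider_body sp uc uB) eqxx.
    move=> x y; rewrite (spider_edge sp) => /orP[]/andP[uc /eqP e].
      by rewrite (up _ _ uc e) orbT.
    by rewrite (up _ _ uc e).
  by rewrite cardsU1 (card_in_imset pinj); case: (_ \notin _).
have [w [wc wB wpB]] : exists w, [/\ w != c, w \notin B & w \notin p @: B].
  have : 0 < #|~: (c |: (B :|: p @: B))|.
    rewrite cardsCs setCK subn_gt0; apply: leq_trans GB.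
    apply: leq_ltn_trans (leq_card_setU _ _) _.
    apply: leq_ltn_trans (leq_add (leqnn _) (leq_card_setU _ _)) _.
    by rewrite cards1 (card_in_imset pinj); clear; lia.
  by case/card_gt0P=> w; rewrite !inE !negb_or => /and3P[? ? ?]; exists w.
have <- : #|w |: B| = #|B|.+1 by rewrite cardsU1 wB.
have Bw b : b \in B -> (b == w) = false by move=> bB; apply: contraNF wB => /eqP<-.
apply: (matching_number_ge (p := [eta p with w |-> c])) => [a b|b].
  have np b' : b' \in B -> c <> p b'.
    by move=> b'B cE; have [_] := spider_legs sp b'B; rewrite -cE eqxx.
  move=> /setU1P[->|aB] /setU1P[->|bB] /=; rewrite ?eqxx ?Bw //.
  - by move/(np b bB).
  - by move/esym/(np a aB).
  - exact: pinj.
move=> /setU1P[->|bB] /=.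
  rewrite eqxx !inE negb_or eq_sym wc (spider_centre sp) //; split=> //.
  by apply/negP=> /(spider_legs sp)[]; rewrite eqxx.
have [bc pc pB] := spider_legs sp bB; rewrite Bw // (spider_up sp) //.
rewrite !inE negb_or pB andbT; split=> //.
by apply: contraNneq wpB => <-; rewrite imset_f.
Qed.

End Matchings.

(** * Recognising the extremal tree *)

Lemma card_inj_exists (T T' : finType) (A : {set T}) (A' : {set T'}) (y0 : T') :
  #|A| = #|A'| ->
  exists h : T -> T', {in A, forall x, h x \in A'} /\ {in A &, injective h}.
Proof.
move=> AA'; exists (fun x => nth y0 (enum A') (index x (enum A))).
have lt x : x \in A -> index x (enum A) < size (enum A').
  by move=> xA; rewrite -cardE -AA' cardE index_mem mem_enum.
split=> [x xA|x y xA yA /eqP]; first by rewrite -mem_enum mem_nth ?lt.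
rewrite nth_uniq ?enum_uniq ?lt // => /eqP.
by apply: (index_inj x); rewrite mem_enum.
Qed.

(** Two spiders of the same size with equally many feet are isomorphic: match
    the centres, the feet, the knees through their feet, and the remaining
    vertices in any way. The resulting map commutes with the parent maps. *)
Lemma spider_iso (G H : sgraph) c p B c' p' B' :
  @spider G [set: G] c p B -> @spider H [set: H] c' p' B' ->
  #|G| = #|H| -> #|B| = #|B'| -> iso G H.
Proof.
move=> sp sp' GH BB'; have pinj := spider_pinj sp; have pinj' := spider_pinj sp'.
have [h [hB hinj]] := card_inj_exists c' BB'.
pose R := [set: G] :\ c :\: B :\: p @: B; pose R' := [set: H] :\ c' :\: B' :\: p' @: B'.
have cardR (K : sgraph) (e : K) f (A : {set K}) : @spider K [set: K] e f A ->
    #|[set: K] :\ e :\: A :\: f @: A| = #|K| - 1 - #|A| - #|A|.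
  move=> [eK [AK fA finj] _ _].
  rewrite (cardsD _ (f @: A)) (setIidPr fA) (cardsD _ A) (setIidPr AK).
  by rewrite (cardsD _ [set e]) setTI cards1 cardsT (card_in_imset finj).
have RR' : #|R| = #|R'| by rewrite (cardR _ _ _ _ sp) (cardR _ _ _ _ sp') GH BB'.
have [g [gR ginj]] := card_inj_exists c' RR'.
pose f u := if u == c then c' else if u \in B then h u else
  if [pick b in B | p b == u] is Some b then p' (h b) else g u.
have fc : f c = c' by rewrite /f eqxx.
have fB b : b \in B -> f b = h b.
  by move=> bB; have [/negPf bc _ _] := spider_legs sp bB; rewrite /f bc bB.
have fp b : b \in B -> f (p b) = p' (h b).
  move=> bB; have [_ /negPf pc /negPf pB] := spider_legs sp bB.
  rewrite /f pc pB; case: pickP => [a /andP[aB /eqP pab]|/(_ b)]; last by rewrite bB eqxx.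
  by rewrite (pinj _ _ aB bB pab).
have fR u : u \in R -> f u = g u.
  rewrite !inE andbT => /and3P[up /negPf uB /negPf uc]; rewrite /f uc uB.
  case: pickP => // b /andP[bB /eqP pbu].
  by case/imsetP: up; exists b.
have cases u : [\/ u = c, u \in B, exists2 b, b \in B & u = p b | u \in R].
  have [->|uc] := eqVneq u c; first by constructor 1.
  have [uB|uB] := boolP (u \in B); first by constructor 2.
  have [/imsetP up|up] := boolP (u \in p @: B); first by constructor 3.
  by constructor 4; rewrite !inE up uB uc.
have gR' u : u \in R -> [/\ g u != c', g u \notin B' & g u \notin p' @: B'].
  by move/gR; rewrite !inE andbT => /and3P[].
have fnc u : u != c -> f u != c'.
  case: (cases u) => [->|uB|[b bB ->]|uR]; first by rewrite eqxx.
  - by rewrite fB // => _; case: (spider_legs sp' (hB _ uB)).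
  - by rewrite fp // => _; case: (spider_legs sp' (hB _ bB)).
  - by rewrite fR // => _; case: (gR' _ uR).
have pf u : u != c -> p' (f u) = f (p u).
  case: (cases u) => [->|uB|[b bB ->]|uR] uc; first by rewrite eqxx in uc.
  - by rewrite fB // fp.
  - have [_ pc' pB'] := spider_legs sp' (hB _ bB); have [_ _ pB] := spider_legs sp bB.
    by rewrite fp // (spider_body sp' pc' pB') (spider_body sp uc pB).
  - have [gc gB _] := gR' u uR; rewrite fR // (spider_body sp' gc gB).
    by move: uR; rewrite !inE andbT => /and3P[_ uB _]; rewrite (spider_body sp).
have inB u : (f u \in B') = (u \in B).
  have cB' : c' \notin B' by apply/negP=> /(spider_legs sp')[]; rewrite eqxx.
  have cB : c \notin B by apply/negP=> /(spider_legs sp)[]; rewrite eqxx.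
  case: (cases u) => [->|uB|[b bB ->]|uR].
  - by rewrite fc (negPf cB) (negPf cB').
  - by rewrite fB // uB hB.
  - have [_ _ /negPf pB'] := spider_legs sp' (hB _ bB).
    by have [_ _ /negPf pB] := spider_legs sp bB; rewrite fp // pB' pB.
  - have [_ /negPf gB _] := gR' u uR; rewrite fR // gB.
    by move: uR; rewrite !inE => /and3P[_ /negPf->].
have finj : injective f.
  move=> u v fuv; have [uc|uc] := eqVneq u c.
    have [->//|/fnc] := eqVneq v c; by rewrite -fuv uc fc eqxx.
  have vc : v != c by apply: contraNneq (fnc _ uc) => vc; rewrite fuv vc fc.
  have Buv : (u \in B) = (v \in B) by rewrite -!inB fuv.
  case: (cases u) uc vc Buv fuv => [->|uB|[b bB ->]|uR]; first by rewrite eqxx.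
  - by rewrite uB => _ _ /esym vB; rewrite !fB //; apply: hinj.
  - have [_ _ /negPf->] := spider_legs sp bB; rewrite fp //.
    case: (cases v) => [->|->//|[a aB ->]|vR]; first by rewrite eqxx.
      by rewrite fp // => _ _ _ /(pinj' _ _ (hB _ bB) (hB _ aB))/(hinj _ _ bB aB)->.
    by rewrite fR // => _ _ _ E; have [_ _] := gR' v vR; rewrite -E imset_f ?hB.
  - have uB : (u \in B) = false by move: uR; rewrite !inE => /and3P[_ /negPf->].
    rewrite fR // uB; case: (cases v) => [->|->//|[a aB ->]|vR]; first by rewrite eqxx.
      by rewrite fp // => _ _ _ E; have [_ _] := gR' u uR; rewrite E imset_f ?hB.
    by rewrite fR // => _ _ _; apply: ginj.
exists f; first by apply: inj_card_bij finj _; rewrite GH.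
have fcE u : (f u == c') = (u == c) by rewrite -fc (inj_eq finj).
have parE u v : (f u != c') && (p' (f u) == f v) = (u != c) && (p u == v).
  by rewrite fcE; have [//|uc] := eqVneq u c; rewrite pf // (inj_eq finj).
by move=> u v; rewrite (spider_edge sp') (spider_edge sp) !parE.
Qed.

Lemma iso_spider (G H : sgraph) c p B :
  iso G H -> @spider H [set: H] c p B ->
  exists c' p' (B' : {set G}), spider [set: G] c' p' B' /\ #|B'| = #|B|.
Proof.
case=> f [g fK gK] fE sp; have ginj := can_inj gK; have finj := can_inj fK.
exists (g c), (g \o p \o f), (g @: B); split; last exact: card_imset.
have gp b : b \in B -> [/\ g b != g c, g (p b) != g c & g (p b) \notin g @: B].
  move=> bB; have [bc pc pB] := spider_legs sp bB.
  by rewrite !(inj_eq ginj) (mem_imset _ _ ginj).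
have gf u : u = g (f u) by rewrite fK.
split; first by rewrite inE.
- split.
  + by apply/subsetP=> _ /imsetP[b bB ->]; rewrite !inE andbT; case: (gp b bB).
  + apply/subsetP=> _ /imsetP[_ /imsetP[b bB ->] ->] /=.
    by rewrite gK !in_setD in_set1 in_setT andbT; have [_ -> ->] := gp b bB.
  + move=> _ _ /imsetP[a aB ->] /imsetP[b bB ->] /=; rewrite !gK => /ginj.
    by move/(spider_pinj sp aB bB)->.
- move=> u; rewrite (gf u) !in_setD in_set1 in_setT andbT /= gK.
  rewrite (mem_imset _ _ ginj) (inj_eq ginj) => /andP[fB fc].
  by rewrite (spider_body sp).
- move=> u v _ _; rewrite -fE (spider_edge sp) /=.
  by rewrite -!(can2_eq fK gK) -!(inj_eq ginj) !fK.
Qed.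

Lemma A_graph_card n q : 0 < q -> 2 * q <= n -> #|A_graph n q| = n.
Proof. by move=> q0 qn; rewrite card_sum card_option !card_ord; lia. Qed.

Lemma A_graph_spider n q : 0 < q -> 2 * q <= n ->
  exists c p (B : {set A_graph n q}), spider [set: A_graph n q] c p B /\ #|B| = q.-1.
Proof.
move=> q0 qn; have qnq : q.-1 <= n - q by lia.
pose c : A_graph n q := inl None.
pose p (u : A_graph n q) : A_graph n q :=
  if u is inr j then inl (Some (widen_ord qnq j)) else c.
pose foot (j : 'I_q.-1) : A_graph n q := inr j.
have finj : injective foot by move=> i j [].
have inB u : (u \in [set foot j | j : 'I_q.-1]) = if u is inr _ then true else false.
  case: u => [x|j]; last by rewrite imset_f.
  by apply/imsetP=> -[].
exists c, p, [set foot j | j : 'I_q.-1]; split; last first.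
  by rewrite card_imset // card_ord.
split; first by rewrite inE.
- split.
  + by apply/subsetP=> _ /imsetP[j _ ->]; rewrite !inE.
  + by apply/subsetP=> _ /imsetP[_ /imsetP[j _ ->] ->]; rewrite in_setD inB !inE.
  + by move=> _ _ /imsetP[i _ ->] /imsetP[j _ ->] [/val_inj->].
- by move=> [x|j]; rewrite in_setD inB.
- by move=> [[i|]|j] [[k|]|l] _ _ //=; rewrite /eq_op /= /eq_op /= ?andbT ?orbF //;
    rewrite eq_sym.
Qed.

(** * The theorem *)

Lemma num_subtreesE G : num_subtrees G = #|csets [set: G] predT|.
Proof. by apply: eq_card => S; rewrite !inE subsetT subtree_cset andbT. Qed.

Lemma num_leaf_subtreesE G : num_leaf_subtrees G = #|csets [set: G] has_leaf|.
Proof. by apply: eq_card => S; rewrite !inE subsetT subtree_cset. Qed.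

Lemma connected_cset G : connected G -> cset [set: G].
Proof.
case/andP=> /card_gt0P[x0 _] Gc; apply/csetP; split.
  by apply/set0Pn; exists x0; rewrite inE.
move=> x y _ _; apply: (connect_map (e := edge) (f := id)) => [u v uv|].
  by rewrite /within !inE.
by have /forallP := forallP Gc x.
Qed.

Lemma tree_nonleaf G : tree G -> 2 < #|G| -> exists2 v, v \in [set: G] & ~~ leaf v.
Proof.
case=> /connected_cset Gc _ G2.
have [/exists_inP//|/exists_inPn allleaf] := boolP [exists v in [set: G], ~~ leaf v].
have /set0Pn[x xG] := cset_neq0 Gc.
have /cards1P[y /setP xE] := negbNE (allleaf x xG).
have /cards1P[z /setP yE] := negbNE (allleaf y (in_setT y)).
have xy : edge x y by have := xE y; rewrite !inE eqxx.
have xz : x = z by apply/eqP; have := yE x; rewrite !inE edge_sym xy => <-.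
have : [set: G] \subset [set x; y].
  apply: (cset_spread Gc xG); first by rewrite !inE eqxx.
  move=> u v _ _ /set2P[]-> uv; rewrite !inE.
    by have := xE v; rewrite !inE uv => <-; rewrite orbT.
  by have := yE v; rewrite !inE uv xz => <-.
by move/subset_leq_card; rewrite cardsT cards2; case: (x != y); rewrite leqNgt ?G2 // ltnW.
Qed.

Lemma iso_refl G : iso G G.
Proof. by exists id => //; exists id. Qed.

Lemma maximizes_iff (P : sgraph -> Prop) (f : sgraph -> nat) (A T : sgraph) v :
  (forall H, P H -> f H <= v /\ (f H = v -> iso H A)) ->
  (forall H, iso H A -> P H /\ v <= f H) ->
  maximizes P f T <-> iso T A.
Proof.
move=> ub lb; have [PA fA] := lb A (iso_refl A).
split=> [[PT Tmax]|TA].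
  have [fT] := ub T PT; apply; apply/eqP; rewrite eqn_leq fT.
  exact: leq_trans (Tmax A PA).
have [PT fT] := lb T TA; split=> // H /ub[fH _]; exact: leq_trans fT.
Qed.

Section Extremal.
Variables q k : nat.
Let n := 2 * q.+1 + k.
Let Aq := A_graph n q.+1.
Let fF := 3 ^ q * 2 ^ k.+1 + 3 * q + k + 1.
Let fL := 3 ^ q * 2 ^ k.+1 + 2 * q + k + 1 - 2 ^ q.

Lemma spider_iso_A G c p B :
  @spider G [set: G] c p B -> #|G| = n -> #|B| = q -> iso G Aq.
Proof.
move=> sp Gn Bq; have qn : 2 * q.+1 <= n by apply: leq_addr.
have [c' [p' [B' [sp' B'q]]]] := A_graph_spider (ltn0Sn q) qn.
by apply: (spider_iso sp sp'); rewrite ?A_graph_card // Bq B'q.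
Qed.

Lemma iso_A_spider G : iso G Aq ->
  trees_with_matching n q.+1 G /\
  exists c p B, @spider G [set: G] c p B /\ #|B| = q.
Proof.
move=> GA; have qn : 2 * q.+1 <= n by apply: leq_addr.
have [c' [p' [B' [sp' B'q]]]] := A_graph_spider (ltn0Sn q) qn.
have [c [p [B [sp BB']]]] := iso_spider GA sp'.
have Bq : #|B| = q by rewrite BB' B'q.
have Gn : #|G| = n.
  by case: GA => f fbij _; rewrite (bij_eq_card fbij) A_graph_card.
split; last by exists c, p, B.
split=> //; first exact: spider_tree sp.
by rewrite (spider_matching_number sp) Bq ?Gn.
Qed.

Lemma tree_involution G : trees_with_matching n q.+1 G ->
  [/\ acyclic G, cset [set: G], #|[set: G]| = 2 * q.+1 + k &
      exists m, matching_on [set: G] m /\ #|covered [set: G] m| = 2 * q.+1].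
Proof.
case=> -[/connected_cset Gc Gac] Gn Gq; split=> //; first by rewrite cardsT.
by have [M matM Mq] := matching_number_attained G; rewrite -Gq -Mq;
  apply: matching_involution.
Qed.

Lemma num_subtrees_le G : trees_with_matching n q.+1 G ->
  num_subtrees G <= fF /\ (num_subtrees G = fF -> iso G Aq).
Proof.
move=> GT; have [Gac Gc Gk [m [mG covG]]] := tree_involution GT; have [_ Gn _] := GT.
rewrite num_subtreesE; have [le eq] := card_csets Gac Gc mG covG Gk.
split=> // /eq[c [p [B [sp Bq]]]]; exact: spider_iso_A sp Gn Bq.
Qed.

Lemma num_subtrees_ge G : iso G Aq ->
  trees_with_matching n q.+1 G /\ fF <= num_subtrees G.
Proof.
case/iso_A_spider=> GT [c [p [B [sp Bq]]]]; have [_ Gn _] := GT.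
by rewrite num_subtreesE; split=> //; apply: spider_card_csets sp _ _ Bq Gn.
Qed.

Lemma num_leaf_subtrees_le G : 2 < n -> trees_with_matching n q.+1 G ->
  num_leaf_subtrees G <= fL /\ (num_leaf_subtrees G = fL -> iso G Aq).
Proof.
move=> n2 GT; have [Gac Gc Gk [m [mG covG]]] := tree_involution GT.
have [Gt Gn _] := GT; have nl := tree_nonleaf Gt; rewrite Gn in nl.
have [le eq] := card_csets_leaf Gac Gc mG covG Gk (nl n2).
have le2 := leq_trans (leq_addl _ _) le.
rewrite num_leaf_subtreesE /fL; split; first by rewrite leq_subRL // addnC.
by move=> eL; have [|c [p [B [sp Bq]]]] := eq;
  [rewrite eL subnK | exact: spider_iso_A sp Gn Bq].
Qed.

Lemma num_leaf_subtrees_ge G : iso G Aq ->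
  trees_with_matching n q.+1 G /\ fL <= num_leaf_subtrees G.
Proof.
case/iso_A_spider=> GT [c [p [B [sp Bq]]]]; have [_ Gn _] := GT.
by rewrite num_leaf_subtreesE leq_subLR [2 ^ q + _]addnC (spider_card_csets_leaf sp Bq).
Qed.

(** The tree with a single edge exceeds the bound [fL]; both its vertices are
    leaves, so there the other count takes over. *)
Lemma num_leaf_subtrees2 G : n = 2 -> trees_with_matching n q.+1 G ->
  num_leaf_subtrees G = num_subtrees G.
Proof.
move=> n2 [[/connected_cset Gc _] Gn _]; rewrite num_subtreesE num_leaf_subtreesE.
rewrite n2 in Gn; have lf (x : G) : leaf x.
  have cx := cardsD1 x [set: G]; rewrite cardsT Gn in_setT in cx.
  have [||y _ xy] := @cset_nbr _ _ x Gc; first by rewrite inE.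
    by apply: contra_eq_neq Gn; rewrite -cardsT => ->; rewrite cards1.
  rewrite /leaf eqn_leq; apply/andP; split; last by apply/card_gt0P; exists y; rewrite inE.
  apply: leq_trans (subset_leq_card (_ : _ \subset [set: G] :\ x)) _.
    by apply/subsetP=> z; rewrite !inE andbT; apply: contraTneq => ->; rewrite edge_irr.
  by move: cx; rewrite add1n => -[<-].
apply: eq_card => S; rewrite !inE /=; congr andb; have [Sc|//] := boolP (cset S).
have /set0Pn[x xS] := cset_neq0 Sc.
by apply/exists_inP; exists x; rewrite ?lf.
Qed.

Lemma maximizes_num_subtrees T :
  maximizes (trees_with_matching n q.+1) num_subtrees T <-> iso T Aq.
Proof. exact: maximizes_iff num_subtrees_le num_subtrees_ge. Qed.

Lemma maximizes_num_leaf_subtrees T :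
  maximizes (trees_with_matching n q.+1) num_leaf_subtrees T <-> iso T Aq.
Proof.
have [n2|n2] := leqP n 2; last first.
  exact: maximizes_iff (fun H => num_leaf_subtrees_le n2) num_leaf_subtrees_ge.
have {}n2 : n = 2 by apply/eqP; rewrite eqn_leq n2 /n mulnS -addnA leq_addr.
apply: (@maximizes_iff _ _ _ _ fF) => H HP.
  by rewrite num_leaf_subtrees2 //; apply: num_subtrees_le.
by have [? ?] := num_subtrees_ge HP; rewrite num_leaf_subtrees2.
Qed.

Lemma num_subtrees_A : num_subtrees Aq = fF.
Proof.
have [P ge] := num_subtrees_ge (iso_refl Aq); have [le _] := num_subtrees_le P.
by apply/eqP; rewrite eqn_leq le.
Qed.

Lemma num_leaf_subtrees_A : 2 < n -> num_leaf_subtrees Aq = fL.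
Proof.
move=> n2; have [P ge] := num_leaf_subtrees_ge (iso_refl Aq).
by have [le _] := num_leaf_subtrees_le n2 P; apply/eqP; rewrite eqn_leq le.
Qed.

End Extremal.

Theorem theorem4p1 (n q : nat) (hq : 0 < q) (hn : 2 * q <= n) :
  [/\ (forall T : sgraph,
         maximizes (trees_with_matching n q) num_subtrees T
         <-> iso T (A_graph n q)),
      num_subtrees (A_graph n q)
        = 2 ^ (n - 2 * q + 1) * 3 ^ (q - 1) + n + q - 2,
      (forall T : sgraph,
         maximizes (trees_with_matching n q) num_leaf_subtrees T
         <-> iso T (A_graph n q))
    & (2 < n ->
       num_leaf_subtrees (A_graph n q)
         = 2 ^ (n - 2 * q + 1) * 3 ^ (q - 1) - 2 ^ (q - 1) + n - 1)].
Proof.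
case: q => // q in hq hn *; have [k nk] : exists k, n = 2 * q.+1 + k.
  by exists (n - 2 * q.+1); rewrite subnKC.
subst n; rewrite addKn subn1 succnK addn1 [_ * 3 ^ _]mulnC.
split; [exact: maximizes_num_subtrees | | exact: maximizes_num_leaf_subtrees | ].
  by rewrite num_subtrees_A; clear; lia.
move=> /num_leaf_subtrees_A->.
have : 2 ^ q <= 3 ^ q * 2 ^ k.+1.
  by apply: leq_trans (leq_pmulr _ (expn_gt0 2 _)); case: q {hq hn} => // q;
    rewrite leq_exp2r.
by clear; lia.
Qed.
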